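(* Let $p$ be an odd prime and let $P$ be a finite $p$-group. For each positive integer $n$, let $a_n(P)$ be the number of subgroups $X \leq P$ such that (i) $X$ is extraspecial of exponent $p$ and order $p^{2n+1}$, and (ii) $\Omega_1(C_P(X)) = Z(X)$. Then, for each nonnegative integer $l$, $$\widetilde{H}_l(\Delta\mathcal{A}_{\geq 2}(P)) \cong \mathbb{Z}^{a_{l+1}(P)\, p^{(l+1)^2}}.$$
   Context: $\mathcal{A}_{\geq 2}(P)$ is the set of elementary abelian subgroups of $P$ having order at least $p^2$, partially ordered by inclusion. For a poset $\mathcal{P}$, the order complex $\Delta\mathcal{P}$ is the abstract simplicial complex whose $k$-dimensional faces are the chains $x_0 < \cdots < x_k$ in $\mathcal{P}$. $\widetilde{H}_l$ denotes reduced integral homology; if $P$ is cyclic then $\Delta\mathcal{A}_{\geq 2}(P) = \{\emptyset\}$, regarded by convention as the $(-1)$-sphere $S^{-1}$. For a $p$-group $Q$, $\Omega_1(Q)$ is the subgroup generated by all elements of order $p$ in $Q$; $Q$ has exponent $p$ if $g^p=1$ for every $g \in Q$; $Q$ is extraspecial if its center $Z(Q)$ has order $p$ and $Q/Z(Q)$ is (nontrivial) elementary abelian. $C_P(X)$ is the centralizer of $X$ in $P$. *)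

(* Defs.v *)
From HB Require Import structures.
From mathcomp Require Import all_boot all_order all_algebra.
From mathcomp Require Import all_fingroup all_solvable.
From mathcomp Require Import zify.
From mathcomp Require Import boolp.

Set Implicit Arguments.
Unset Strict Implicit.
Unset Printing Implicit Defensive.

Import Order.TTheory GRing.Theory Num.Theory.
Local Open Scope ring_scope.

Section OrderComplex.

Variables (d : Order.disp_t) (T : finPOrderType d).
Implicit Types n l : nat.

(* A face of the order complex with [n] vertices (dimension [n - 1]), listed   *)
(* increasingly; [face 0] is the empty face only.                             *)
Definition face n := {t : n.-tuple T | sorted <%O t}.

Definition del_vertex n (t : n.+1.-tuple T) (i : 'I_n.+1) : n.-tuple T :=
  [tuple tnth t (lift i j) | j < n].

(* Free abelian group on the faces with [n] vertices.                         *)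
Definition chains n := {ffun face n -> int}.
HB.instance Definition _ n := GRing.Zmodule.on (chains n).

(* On basis elements, d [x_0 < ... < x_n] is the sum over i of                *)
(* (-1)^i [x_0 < .. omit x_i .. < x_n]; for [n = 0] this is the augmentation. *)
Definition boundary n (c : chains n.+1) : chains n :=
  [ffun s : face n => \sum_(t : face n.+1)
     \sum_(i < n.+1 | val s == del_vertex (val t) i) (-1) ^+ i * c t].

Lemma boundary_is_zmod_morphism n : zmod_morphism (@boundary n).
Proof.
move=> b c; apply/ffunP=> s; rewrite !ffunE -sumrB; apply: eq_bigr => t _.
by rewrite -sumrB; apply: eq_bigr => i _; rewrite !ffunE mulrBr.
Qed.

HB.instance Definition _ n :=
  GRing.isZmodMorphism.Build (chains n.+1) (chains n) (@boundary n)
    (@boundary_is_zmod_morphism n).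

Lemma sorted_del_vertex n (t : n.+1.-tuple T) i :
  sorted <%O t -> sorted <%O (del_vertex t i).
Proof.
move=> st; case: n t i st => [t i _|n t i st].
  by rewrite tuple0.
have x0 := thead t.
apply/(sortedP x0) => k; rewrite size_tuple => lt_k.
have lk : (k < n.+1)%N by apply: ltnW.
have := tnth_nth x0 (del_vertex t i) (Ordinal lk).
have := tnth_nth x0 (del_vertex t i) (Ordinal lt_k).
rewrite !tnth_mktuple /= => <- <-.
rewrite !(tnth_nth x0); apply: (sorted_ltn_nth lt_trans) => //.
- by rewrite inE size_tuple ltn_ord.
- by rewrite inE size_tuple ltn_ord.
by rewrite /= /bump; lia.
Qed.

Lemma del_vertexC n (u : n.+2.-tuple T) (j : 'I_n.+2) (i : 'I_n.+1) 
   (j' : 'I_n.+2) (i' : 'I_n.+1) : (i < j)%N -> i = j' :> nat -> i' = j.-1 :> nat ->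
   del_vertex (del_vertex u j) i = del_vertex (del_vertex u j') i'.
Proof.
move=> lij ej ei; apply: eq_from_tnth => k; rewrite !tnth_mktuple.
congr tnth; apply: val_inj; rewrite /= /bump ei -ej. 
lia.
Qed.

Lemma boundaryK n (c : chains n.+2) : boundary (boundary c) = 0.
Proof.
apply/ffunP=> s; rewrite !ffunE.
pose G (u : face n.+2) (j : 'I_n.+2) (i : 'I_n.+1) : int :=
  if val s == del_vertex (del_vertex (val u) j) i then (-1) ^+ (i + j) else 0.
have -> : \sum_(t : face n.+1) \sum_(i < n.+1 | val s == del_vertex (val t) i)
     (-1) ^+ i * boundary c t = \sum_u c u * \sum_j \sum_i G u j i.
  under eq_bigr => t _ do under eq_bigr => i _ do rewrite ffunE mulr_sumr.
  under eq_bigr => t _ do rewrite exchange_big.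
  rewrite exchange_big; apply: eq_bigr => u _ /=.
  under eq_bigr => t _ do under eq_bigr => i _ do rewrite mulr_sumr.
  under eq_bigr => t _ do rewrite exchange_big big_mkcond /=.
  rewrite exchange_big mulr_sumr; apply: eq_bigr => j _ /=.
  pose t0 : face n.+1 := exist (fun t : n.+1.-tuple T => sorted <%O t) _ (sorted_del_vertex j (valP u)).
  rewrite (bigD1 t0) //= eqxx [X in _ + X]big1 ?addr0; last first.
    move=> t /eqP nt. rewrite ifF //; apply/eqP => e; case: nt; exact: val_inj.
  rewrite mulr_sumr big_mkcond; apply: eq_bigr => i _.
  by rewrite /G; case: ifP; rewrite ?mulr0 // exprD mulrA mulrC.
apply: big1 => u _; rewrite pair_big /= (bigID (fun q : 'I_n.+2 * 'I_n.+1 => (q.2 < q.1)%N)) /=.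
set A := \sum_(_ | _) _; set B := \sum_(_ | _) _.
suff -> : B = - A by rewrite subrr mulr0.
rewrite /A /B -sumrN.
pose f (q : 'I_n.+2 * 'I_n.+1) : 'I_n.+2 * 'I_n.+1 := (inord q.2, inord q.1.-1).
pose g (q : 'I_n.+2 * 'I_n.+1) : 'I_n.+2 * 'I_n.+1 := (inord q.2.+1, inord q.1).
rewrite (reindex_onto f g) /=; last first.
  move=> [j i] /= h; congr pair; apply: val_inj; have := ltn_ord i => hi; rewrite /= !inordK //= ?inordK //; lia.
apply: eq_big => [[j i] | [j i]] /=; have := ltn_ord i; have := ltn_ord j => hj hi.
  apply/idP/idP => [|h].
    move=> /andP[h /eqP[e1 _]]; move: h. move: e1; move/(congr1 val) => /=.
    have [->|j0] := posnP j; last by rewrite !inordK ?inordK //; lia.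
    rewrite /= inordK // ?inordK //.
  apply/andP; split; first by rewrite !inordK //; lia.
  apply/eqP; congr pair; apply: val_inj; rewrite /= !inordK //= ?inordK //; lia.
move=> /andP[h /eqP[e1 _]].
have lij : (i < j)%N.
  by move: e1 => /(congr1 val) /=; rewrite !inordK //; first (move=> <-; move: h; rewrite !inordK //); lia.
have e2 : nat_of_ord (inord i : 'I_n.+2) = i by rewrite inordK //; lia.
have e3 : nat_of_ord (inord j.-1 : 'I_n.+1) = j.-1 by rewrite inordK //; lia.
rewrite /G -(@del_vertexC _ (val u) j i (inord i) (inord j.-1)) // e2 e3.
case: ifP => _; last by rewrite oppr0.
rewrite -signr_odd -[in RHS]signr_odd.
have -> : odd (i + j) = ~~ odd (j.-1 + i) by lia.
by case: (odd _); rewrite ?opprK.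
Qed.
Definition is_cycle n : {pred chains n.+1} := [pred c | boundary c == 0].

Lemma is_cycle_zmod_closed n : zmod_closed (@is_cycle n).
Proof.
split=> [|b c]; rewrite !inE ?raddf0 // => /eqP db /eqP dc.
by rewrite raddfB /= db dc subrr.
Qed.

HB.instance Definition _ n :=
  GRing.isZmodClosed.Build (chains n.+1) (@is_cycle n)
    (@is_cycle_zmod_closed n).

Record cycles n := Cycle { cycle_val :> chains n.+1; _ : cycle_val \in @is_cycle n }.
HB.instance Definition _ n := [isSub for @cycle_val n].
HB.instance Definition _ n := [Choice of cycles n by <:].
HB.instance Definition _ n :=
  [SubChoice_isSubZmodule of cycles n by <:].

Definition is_boundary n : {pred cycles n} :=
  [pred z | `[< exists b : chains n.+2, boundary b = val z >]].

Lemma is_boundary_zmod_closed n : zmod_closed (@is_boundary n).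
Proof.
split=> [|x y]; rewrite !inE.
  by apply/asboolP; exists 0; rewrite raddf0.
move=> /asboolP[b db] /asboolP[c dc]; apply/asboolP; exists (b - c).
by rewrite raddfB /= db dc.
Qed.

HB.instance Definition _ n :=
  GRing.isZmodClosed.Build (cycles n) (@is_boundary n)
    (@is_boundary_zmod_closed n).

(* Faces of dimension [l] have [l + 1] vertices, so this is the homology at   *)
(* [chains l.+1].                                                             *)
Definition reduced_homology l : zmodType := Quotient.quot (@is_boundary l).

End OrderComplex.

Definition zmod_isog (U V : zmodType) : Prop :=
  exists f : {additive U -> V}, bijective f.

Local Open Scope group_scope.

Section Groups.

Variables (gT : finGroupType) (p : nat) (P : {group gT}).

Definition abelem_ge2 : Type :=
  {E : {group gT} | (E \in 'E_p(P)) && (p ^ 2 <= #|E|)%N}.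
HB.instance Definition _ := Finite.on abelem_ge2.

Definition abelem_ge2_le (E F : abelem_ge2) : bool := val E \subset val F.

Lemma abelem_ge2_le_refl : reflexive abelem_ge2_le.
Proof. by move=> E; apply: subxx. Qed.

Lemma abelem_ge2_le_anti : antisymmetric abelem_ge2_le.
Proof.
move=> E F sEF; apply: val_inj; apply: val_inj; apply/eqP.
by rewrite eqEsubset.
Qed.

Lemma abelem_ge2_le_trans : transitive abelem_ge2_le.
Proof. by move=> F E G; apply: subset_trans. Qed.

Fact abelem_ge2_display : Order.disp_t. Proof. exact: Order.Disp tt tt. Qed.

HB.instance Definition _ :=
  Order.Le_isPOrder.Build abelem_ge2_display abelem_ge2
    abelem_ge2_le_refl abelem_ge2_le_anti abelem_ge2_le_trans.

End Groups.

(* Extraspecial [p]-groups; the library's [extraspecial] is Prop-valued, and  *)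
(* [pextraspecialP] shows that it agrees with this one on [p]-groups.         *)
Definition pextraspecial (gT : finGroupType) (p : nat) (Q : {group gT}) : bool :=
  [&& #|'Z(Q)| == p, p.-abelem (Q / 'Z(Q)) & Q / 'Z(Q) != 1].

Lemma pextraspecialP (gT : finGroupType) (p : nat) (Q : {group gT}) :
  prime p -> p.-group Q -> reflect (extraspecial Q) (pextraspecial p Q).
Proof.
move=> p_pr pQ; apply: (iffP and3P) => [[/eqP oZ abQ ntQ] | esQ].
  have sQN := normal_norm (center_normal Q).
  have sPhiZ: 'Phi(Q) \subset 'Z(Q) by rewrite (Phi_min pQ) .
  have nabQ: ~~ abelian Q.
    apply: contra ntQ => abelQ; move/center_idP: abelQ => ->.
    by rewrite trivg_quotient.
  have ntQ': Q^`(1) != 1 by apply: contra nabQ => /eqP/derG1P.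
  have sQ'Phi: Q^`(1) \subset 'Phi(Q) by rewrite (Phi_joing pQ) joing_subl.
  have eqQ'Z: Q^`(1) = 'Z(Q).
    have/prime_meetG prZ: prime #|'Z(Q)| by rewrite oZ.
    apply/eqP; rewrite eqEsubset (subset_trans sQ'Phi) //.
    apply: prZ; rewrite (setIidPr _) //.
    exact: subset_trans sQ'Phi _.
  split; last by rewrite oZ.
  split=> //; apply/eqP; rewrite eqEsubset sPhiZ /=.
  by rewrite -{1}eqQ'Z.
have oZ := card_center_extraspecial pQ esQ.
have nabQ := extraspecial_nonabelian esQ.
case: (esQ) => [[PhiZ _] _]; split; first by rewrite oZ.
  by rewrite -PhiZ Phi_quotient_abelem.
apply: contra nabQ => /eqP Q1; apply/center_idP/eqP.
rewrite eqEsubset center_sub /= -quotient_sub1 ?Q1 ?sub1G //.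
exact: normal_norm (center_normal Q).
Qed.

Definition extraspecial_count (gT : finGroupType) (p : nat) (P : {group gT})
    (n : nat) : nat :=
  #|[set X : {group gT} | [&& X \subset P,
      [&& pextraspecial p X, (exponent X %| p)%N & #|X| == (p ^ n.*2.+1)%N]
      & 'Ohm_1('C_P(X)) == 'Z(X)]]|.

(* Main.v *)
Require Import Defs.
From HB Require Import structures.
From mathcomp Require Import all_boot all_order all_algebra.
From mathcomp Require Import all_fingroup all_solvable.
From mathcomp Require Import freeg zify.
From mathcomp Require Import boolp.

Set Implicit Arguments.
Unset Strict Implicit.
Unset Printing Implicit Defensive.

Import Order.TTheory GRing.Theory.

(** Let Z be a subgroup of order p of the center of P. For Z <= Q <= P let A(Q) be the
    poset of the elementary abelian subgroups E of Q that properly contain Z. As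
    E <= E Z, the whole poset has the homology of A(P) ([free_homology_all]), and the
    homology of all A(Q) is computed together ([free_homology_above]).

    If Ohm_1(Z(Q)) = W is larger than Z, then E <= E W >= W shows that A(Q) is
    acyclic. Otherwise, unless A(Q) is empty, there is a normal elementary abelian
    subgroup E0 of Q of order p^2 over Z, because p is odd; its centralizer M has
    index p in Q. The E in A(Q) with E :&: M <> Z form an acyclic poset, since
    E >= E :&: M <= (E :&: M) E0 >= E0. The other elements of A(Q) are subgroups F of
    order p^2 with F :&: M = Z. They are minimal, and the elements strictly above F
    correspond to those of A(C_M(F)) under E |-> E :&: M and E |-> F E. Therefore A(Q)
    has the homology of a wedge of suspensions ([free_homology_minimal]):
    the homology of A(Q) in degree l is the direct sum over F of that of A(C_M(F)) in
    degree l - 1. The recursion ends with empty posets, that is, spheres of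
    dimension -1.

    The subgroups to be counted obey the same recursion. Let X <= Q be extraspecial of
    exponent p with Ohm_1(C_Q(X)) = Z(X) = Z. Every element of E0 acts on X as an
    element of X does, which forces E0 <= X ([counted_E0]). Given F as above inside X,
    C_X(E0 F) is a subgroup of C_M(F) of the same kind and of order |X| / p^2; and
    every such subgroup Y of C_M(F) arises from exactly one X over F, namely
    X = E0 F Y ([card_counted_off_line]). An X of order p^(2n+3) contains p^(2n+1)
    subgroups F ([card_off_line_in]), and (n+1)^2 = (2n+1) + n^2 accounts for the
    exponent of p ([sum_card_counted]).

    On the topological side, chains are formal sums of sequences of vertices with a
    boundary defined by recursion on the sequence. The prism between two comparable
    monotone maps is then a recursive formula on weakly increasing sequences, and
    projecting away the sequences with repetitions turns it into a homotopy between
    maps of order complexes ([pushforward_homotopy]). *)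

(** * Integral chains on a set of generators *)

Section FreeChains.
Local Open Scope ring_scope.
Variable K : choiceType.

Definition fchain : Type := {freeg K / int}.
HB.instance Definition _ := GRing.Lmodule.on fchain.

Definition gen (t : K) : fchain := << t >>.
Definition coef (t : K) (c : fchain) : int := coeff t c.

Lemma coef_is_zmod_morphism t : zmod_morphism (coef t).
Proof. exact: coeff_is_additive. Qed.
HB.instance Definition _ t :=
  GRing.isZmodMorphism.Build fchain int (coef t) (coef_is_zmod_morphism t).

Lemma coef_gen t u : coef t (gen u) = (u == t)%:R.
Proof. by rewrite /coef coeffU mul1r. Qed.

Definition supp (P : pred K) (c : fchain) : Prop :=
  forall t, coef t c != 0 -> P t.

Lemma supp_gen (P : pred K) t : P t -> supp P (gen t).
Proof. by move=> Pt u; rewrite coef_gen; case: (eqVneq t u) => [<-|]; rewrite ?eqxx. Qed.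

Lemma supp0 P : supp P 0.
Proof. by move=> t; rewrite raddf0 eqxx. Qed.

Lemma suppD P c e : supp P c -> supp P e -> supp P (c + e).
Proof.
move=> hc he t; rewrite raddfD /= => nz.
have [c0|/hc//] := eqVneq (coef t c) 0.
by apply: he; move: nz; rewrite c0 add0r.
Qed.

Lemma suppN P c : supp P c -> supp P (- c).
Proof. by move=> hc t; rewrite raddfN oppr_eq0 => /hc. Qed.

Lemma suppB P c e : supp P c -> supp P e -> supp P (c - e).
Proof. by move=> hc he; apply: suppD => //; apply: suppN. Qed.

Lemma suppMz P c (k : int) : supp P c -> supp P (c *~ k).
Proof.
move=> hc t; rewrite raddfMz /=.
by have [->|/hc//] := eqVneq (coef t c) 0; rewrite mul0rz.
Qed.

Lemma supp_sum P (I : Type) (r : seq I) (Q : pred I) (F : I -> fchain) :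
  (forall i, Q i -> supp P (F i)) -> supp P (\sum_(i <- r | Q i) F i).
Proof.
by move=> h; elim/big_ind: _ => //; [apply: supp0 | apply: suppD].
Qed.

Lemma sub_supp (P Q : pred K) c :
  (forall t, P t -> Q t) -> supp P c -> supp Q c.
Proof. by move=> PQ hc t /hc /PQ. Qed.

Lemma fchain_sum c : c = \sum_(t <- dom c) gen t *~ coef t c.
Proof.
rewrite -[LHS]freeg_sumE; apply: eq_bigr => t _.
by rewrite freegU_mulz intz.
Qed.

Lemma supp_dom P c t : supp P c -> t \in dom c -> P t.
Proof. by move=> hc; rewrite mem_dom; apply: hc. Qed.

(** Identities between operators on chains are checked on generators; supports are
    tracked along the way because several operators behave well only on the
    generators coming from simplices. *)
Lemma additive_ext (V : zmodType) (P : pred K) (f g : {additive fchain -> V}) c :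
  (forall t, P t -> f (gen t) = g (gen t)) -> supp P c -> f c = g c.
Proof.
move=> fg hc; rewrite (fchain_sum c) !raddf_sum big_seq [RHS]big_seq.
by apply: eq_bigr => t ct; rewrite !raddfMz (fg _ (supp_dom hc ct)).
Qed.

Lemma supp_additive (P Q : pred K) (f : {additive fchain -> fchain}) c :
  (forall t, P t -> supp Q (f (gen t))) -> supp P c -> supp Q (f c).
Proof.
move=> hf hc; rewrite (fchain_sum c) raddf_sum big_seq.
apply: supp_sum => t ct; rewrite raddfMz; apply/suppMz/hf; exact: supp_dom ct.
Qed.

Definition lin (f : K -> fchain) (c : fchain) : fchain := fglift f c.
Lemma lin_is_zmod_morphism f : zmod_morphism (lin f).
Proof. exact: lift_is_additive. Qed.
HB.instance Definition _ f :=
  GRing.isZmodMorphism.Build fchain fchain (lin f) (lin_is_zmod_morphism f).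

Lemma lin_gen f t : lin f (gen t) = f t.
Proof. by rewrite /lin liftU scale1r. Qed.

End FreeChains.

(** * Chains of a poset and comparable maps *)

Section Sequences.
Local Open Scope ring_scope.
Variables (d : Order.disp_t) (T : finPOrderType d).
Local Notation chn := (fchain (seq T)).
Implicit Types (c e : chn) (t u : seq T) (x y : T) (S : pred T) (n : nat).

Definition cone x : chn -> chn := lin (fun t => gen (x :: t)).
HB.instance Definition _ x := GRing.Additive.on (cone x).
Lemma cone_gen x t : cone x (gen t) = gen (x :: t).
Proof. exact: lin_gen. Qed.

(** The alternating sum of vertex deletions, organized by the first vertex. It is
    defined for arbitrary sequences, since monotone maps send simplices to
    sequences with repeated vertices. *)
Fixpoint bdry_seq t : chn :=
  if t is x :: u then gen u - cone x (bdry_seq u) else 0.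
Definition bdry : chn -> chn := lin bdry_seq.
HB.instance Definition _ := GRing.Additive.on bdry.
Lemma bdry_nil : bdry (gen [::]) = 0. Proof. exact: lin_gen. Qed.

Lemma bdry_cons x t : bdry (gen (x :: t)) = gen t - cone x (bdry (gen t)).
Proof. by rewrite /bdry !lin_gen. Qed.

Let extT (V : zmodType) (f g : {additive chn -> V}) c :
  (forall t, f (gen t) = g (gen t)) -> f c = g c.
Proof. by move=> fg; apply: (@additive_ext _ V xpredT) => // t _. Qed.

Lemma bdry_cone x c : bdry (cone x c) = c - cone x (bdry c).
Proof.
apply: (extT (f := bdry \o cone x) (g := idfun \- (cone x \o bdry))) => t /=.
by rewrite cone_gen bdry_cons.
Qed.

Lemma bdryK c : bdry (bdry c) = 0.
Proof.
apply: (extT (f := bdry \o bdry) (g := \0)) => t /=.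
elim: t => [|x t IH]; first by rewrite bdry_nil raddf0.
by rewrite bdry_cons raddfB /= bdry_cone IH raddf0 subr0 subrr.
Qed.

(** Formulas such as that of [prism_seq] are uniform on weakly increasing
    sequences; the simplices are recovered by killing the degenerate ones. *)
Definition normalize : chn -> chn :=
  lin (fun t => if sorted <%O t then gen t else 0).
HB.instance Definition _ := GRing.Additive.on normalize.
Lemma normalize_gen t : normalize (gen t) = if sorted <%O t then gen t else 0.
Proof. exact: lin_gen. Qed.

Lemma normalize_id c : supp (sorted <%O) c -> normalize c = c.
Proof.
apply: (additive_ext (f := normalize) (g := idfun)) => t /= st.
by rewrite normalize_gen st.
Qed.

Lemma normalize_cone x c : normalize c = 0 -> normalize (cone x c) = 0.
Proof.
suff -> : normalize (cone x c) = normalize (cone x (normalize c)) by move=> ->; rewrite !raddf0.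
apply: (extT (f := normalize \o cone x) (g := normalize \o cone x \o normalize)) => t /=.
rewrite normalize_gen; case: ifP => // nst; rewrite cone_gen normalize_gen !raddf0.
by case: ifP => //= st; rewrite (path_sorted st) in nst.
Qed.

(** Deleting either of two equal adjacent vertices gives the same sequence with
    opposite signs, and deleting any other vertex leaves the repetition in place. *)
Lemma normalize_bdry_degenerate t :
  sorted <=%O t -> ~~ sorted <%O t -> normalize (bdry (gen t)) = 0.
Proof.
elim: t => [|x t IH] // wt nst; rewrite bdry_cons raddfB /=.
have wt' : sorted <=%O t := path_sorted wt.
have [st|nst'] := boolP (sorted <%O t); last first.
  by rewrite normalize_gen (negPf nst') normalize_cone ?subrr // IH.
case: t => [|y t] //= in wt nst st wt' IH *.
have exy : x = y.
  by apply/eqP; move: wt nst; rewrite st andbT le_eqVlt => /andP[/orP[|->]].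
rewrite exy bdry_cons raddfB /= cone_gen raddfB /= opprB addrCA subrr addr0.
move: (bdry _) => e.
apply: (extT (f := normalize \o cone y \o cone y) (g := \0)) => u /=.
by rewrite !cone_gen normalize_gen /= ltxx.
Qed.

(** Degenerate sequences span a subcomplex of the weakly increasing ones, so
    normalizing before taking the boundary makes no difference afterwards. *)
Lemma normalize_bdry c : supp (sorted <=%O) c ->
  normalize (bdry (normalize c)) = normalize (bdry c).
Proof.
apply: (additive_ext (f := normalize \o bdry \o normalize) (g := normalize \o bdry)) => t wt /=.
rewrite normalize_gen; case: ifP => [//|nst].
by rewrite normalize_bdry_degenerate ?nst // !raddf0.
Qed.

(** Here and below [n] counts vertices, so that these are the simplices of
    dimension [n - 1] of the order complex of [S], with the empty one at [n = 0]. *)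
Definition simplex S n t := [&& sorted <%O t, all S t & size t == n].
Definition chain_on S n c := supp (simplex S n) c.
Definition cycle_on S n c := chain_on S n c /\ bdry c = 0.
Definition boundary_on S n c := exists2 e, chain_on S n.+1 e & bdry e = c.
Definition acyclic_on S n := forall c, cycle_on S n c -> boundary_on S n c.

Lemma chain_on_sorted S n c : chain_on S n c -> supp (sorted <%O) c.
Proof. by apply: sub_supp => t /and3P[]. Qed.

Lemma sub_chain_on (S S' : pred T) n c :
  (forall x, S x -> S' x) -> chain_on S n c -> chain_on S' n c.
Proof.
move=> sub; apply: sub_supp => t /and3P[st h sz].
by apply/and3P; split=> //; apply: sub_all h.
Qed.

Lemma sorted_ltP x t : sorted <%O (x :: t) = all (fun y => x < y)%O t && sorted <%O t.
Proof. exact: (path_sortedE lt_trans). Qed.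

Lemma chain_on_cone S S' n x c :
  S' x -> (forall y, S y -> S' y && (x < y)%O) -> chain_on S n c -> chain_on S' n.+1 (cone x c).
Proof.
move=> Sx h; apply: (supp_additive (f := cone x)) => t /and3P[st at_ /eqP <-].
rewrite /= cone_gen; apply: supp_gen; rewrite /simplex sorted_ltP st /= eqxx !andbT Sx /=.
by apply/andP; split; apply: sub_all at_ => y /h /andP[].
Qed.

Lemma chain_on_bdry S n c : chain_on S n.+1 c -> chain_on S n (bdry c).
Proof.
apply: (supp_additive (f := bdry)) => t; elim: t S n => [|x t IH] S n //.
move=> /and3P[]; rewrite sorted_ltP => /andP[xt st] /= /andP[Sx St] /eqP[sz].
rewrite bdry_cons; apply: suppB; first by apply: supp_gen; rewrite /simplex st St sz /=.
case: t => [|y t] // in IH xt st St sz *.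
  by rewrite bdry_nil raddf0; apply: supp0.
case: n sz => // n sz.
(* The faces of the tail stay above x, hence can be coned off with x. *)
apply: (@chain_on_cone [pred y | S y & (x < y)%O]) => //.
apply: IH; apply/and3P; split; [exact: st | | by rewrite sz].
by apply/allP => z zt; apply/andP; split; [apply: (allP St) | apply: (allP xt)].
Qed.

Definition map_chain (f : T -> T) : chn -> chn := lin (fun t => gen (map f t)).
HB.instance Definition _ f := GRing.Additive.on (map_chain f).
Lemma map_chain_gen f t : map_chain f (gen t) = gen (map f t). Proof. exact: lin_gen. Qed.

Lemma map_chain_cone f x c : map_chain f (cone x c) = cone (f x) (map_chain f c).
Proof.
apply: (extT (f := map_chain f \o cone x) (g := cone (f x) \o map_chain f)) => t /=.
by rewrite map_chain_gen !cone_gen map_chain_gen.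
Qed.

Lemma bdry_map_chain f c : bdry (map_chain f c) = map_chain f (bdry c).
Proof.
apply: (extT (f := bdry \o map_chain f) (g := map_chain f \o bdry)) => t /=.
elim: t => [|x t IH]; first by rewrite map_chain_gen bdry_nil raddf0.
by rewrite map_chain_gen /= !bdry_cons -map_chain_gen IH raddfB /= map_chain_cone !map_chain_gen.
Qed.

Section Prism.
Variables f g : T -> T.
(** The sum of (-1)^i [f x_0, .., f x_i, g x_i, .., g x_n], again organized by the
    first vertex. *)
Fixpoint prism_seq t : chn :=
  if t is x :: u then gen (f x :: g x :: map g u) - cone (f x) (prism_seq u)
  else 0.
Definition prism : chn -> chn := lin prism_seq.
HB.instance Definition _ := GRing.Additive.on prism.

Lemma prism_nil : prism (gen [::]) = 0. Proof. exact: lin_gen. Qed.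

Lemma prism_cone x c :
  prism (cone x c) = cone (f x) (cone (g x) (map_chain g c)) - cone (f x) (prism c).
Proof.
apply: (extT (f := prism \o cone x)
  (g := (cone (f x) \o cone (g x) \o map_chain g) \- (cone (f x) \o prism))) => t /=.
by rewrite map_chain_gen !cone_gen /prism !lin_gen.
Qed.

(** The prism is a chain homotopy from f to g already for arbitrary maps and
    arbitrary sequences; the order enters in [prism_supp]. *)
Lemma bdry_prism c : bdry (prism c) = map_chain g c - map_chain f c - prism (bdry c).
Proof.
apply: (extT (f := bdry \o prism)
  (g := (map_chain g \- map_chain f) \- (prism \o bdry))) => t /=.
elim: t => [|x t IH].
  by rewrite prism_nil !map_chain_gen bdry_nil !raddf0 subrr addr0.
rewrite -!cone_gen prism_cone !bdry_cone (raddfB bdry) (raddfB prism) /=.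
rewrite prism_cone !bdry_cone bdry_map_chain IH !map_chain_cone !(raddfB (cone (f x))) /=.
by rewrite !opprB -!addrA addKr; congr (_ + _); rewrite addrCA.
Qed.

Definition weak_simplex S n t := [&& sorted <=%O t, all S t & size t == n].

Lemma weak_simplex_cone (S S' : pred T) n x c :
  S' x -> (forall y, S y -> S' y && (x <= y)%O) ->
  supp (weak_simplex S n) c -> supp (weak_simplex S' n.+1) (cone x c).
Proof.
move=> Sx h; apply: (supp_additive (f := cone x)) => t /and3P[st at_ /eqP <-].
rewrite /= cone_gen; apply: supp_gen; apply/and3P; split=> //=; last first.
  by rewrite Sx; apply: sub_all at_ => y /h /andP[].
by rewrite (path_sortedE le_trans) st andbT; apply: sub_all at_ => y /h /andP[].
Qed.

Lemma simplex_weak S n t : simplex S n t -> weak_simplex S n t.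
Proof.
case/and3P=> st at_ sz; apply/and3P; split=> //.
by apply: sub_sorted st => x y /ltW.
Qed.

Lemma weak_simplex_map (S S' : pred T) n (h : T -> T) t :
  (forall x, S x -> S' (h x)) ->
  (forall x y, S x -> S y -> x <= y -> h x <= h y)%O ->
  weak_simplex S n t -> weak_simplex S' n (map h t).
Proof.
move=> hS hm /and3P[st at_ sz]; apply/and3P; split; last by rewrite size_map.
  by apply: (homo_sorted_in _ at_ st) => x y Sx Sy; apply: hm.
by rewrite all_map; apply: sub_all at_ => x /hS.
Qed.

(** Monotonicity and f <= g make f x_0 <= .. <= f x_i <= g x_i <= .. <= g x_n. The
    induction on the tail restricts S to the elements above the first vertex x and
    S' to those above f x, which allows the prism of the tail to be coned off. *)
Lemma prism_supp (S S' : pred T) n t :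
  (forall x, S x -> S' (f x)) -> (forall x, S x -> S' (g x)) ->
  (forall x y, S x -> S y -> x <= y -> f x <= f y)%O ->
  (forall x y, S x -> S y -> x <= y -> g x <= g y)%O ->
  (forall x, S x -> f x <= g x)%O ->
  weak_simplex S n t -> supp (weak_simplex S' n.+1) (prism (gen t)).
Proof.
elim: t S S' n => [|x t IH] S S' n hf hg mf mg fg wt.
  by rewrite prism_nil; apply: supp0.
have /and3P[/= xt /andP[Sx St] /eqP sz] := wt.
move: xt; rewrite (path_sortedE le_trans) => /andP[xt st].
rewrite -cone_gen prism_cone; apply: suppB.
  rewrite map_chain_gen !cone_gen; apply: supp_gen; apply/and3P.
  have /and3P[h1 /= h2 h3] := weak_simplex_map hg mg wt; split.
  - by rewrite /= fg //; apply: h1.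
  - by rewrite /= hf.
  - by rewrite /= size_map sz.
case: n sz wt => // n [sz] _.
apply: (@weak_simplex_cone [pred y | S' y & (f x <= y)%O]) => //; first exact: hf.
apply: (IH [pred y | S y & (x <= y)%O]) => /=.
- by move=> y /andP[Sy xy]; rewrite hf ?mf.
- by move=> y /andP[Sy xy]; rewrite hg // (le_trans (fg _ Sx)) // mg.
- by move=> y z /andP[Sy _] /andP[Sz _]; apply: mf.
- by move=> y z /andP[Sy _] /andP[Sz _]; apply: mg.
- by move=> y /andP[Sy _]; apply: fg.
apply/and3P; split=> //; last by rewrite sz.
by apply/allP => y yt; apply/andP; split; [apply: (allP St) | apply: (allP xt)].
Qed.

End Prism.

Lemma chain_on_normalize S n c : supp (weak_simplex S n) c -> chain_on S n (normalize c).
Proof.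
apply: (supp_additive (f := normalize)) => t /and3P[_ h1 h2] /=; rewrite normalize_gen.
by case: ifP => st; [apply/supp_gen/and3P | apply: supp0].
Qed.

Lemma sorted_bdry S n c : chain_on S n c -> supp (sorted <%O) (bdry c).
Proof.
case: n => [|n] h; last exact: chain_on_sorted (chain_on_bdry h).
suff -> : bdry c = 0 by apply: supp0.
apply: (additive_ext (f := bdry) (g := \0)) h => t /and3P[_ _ /nilP ->].
exact: bdry_nil.
Qed.

Lemma supp_map_chain (S S' : pred T) n (h : T -> T) c :
  (forall x, S x -> S' (h x)) ->
  (forall x y, S x -> S y -> x <= y -> h x <= h y)%O ->
  chain_on S n c -> supp (weak_simplex S' n) (map_chain h c).
Proof.
move=> hS hm; apply: (supp_additive (f := map_chain h)) => t /simplex_weak wt /=.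
rewrite map_chain_gen; apply: supp_gen; exact: weak_simplex_map wt.
Qed.

Lemma weak_simplex_sorted S n c : supp (weak_simplex S n) c -> supp (sorted <=%O) c.
Proof. by apply: sub_supp => t /and3P[]. Qed.

Definition pushforward h c := normalize (map_chain h c).
HB.instance Definition _ h :=
  GRing.Additive.copy (pushforward h) (normalize \o map_chain h).

Lemma chain_on_pushforward (S S' : pred T) n (h : T -> T) c :
  (forall x, S x -> S' (h x)) ->
  (forall x y, S x -> S y -> x <= y -> h x <= h y)%O ->
  chain_on S n c -> chain_on S' n (pushforward h c).
Proof. by move=> hS hm hc; apply/chain_on_normalize/(supp_map_chain hS hm). Qed.

Lemma bdry_pushforward (S S' : pred T) n (h : T -> T) c :
  (forall x, S x -> S' (h x)) ->
  (forall x y, S x -> S y -> x <= y -> h x <= h y)%O ->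
  chain_on S n c -> bdry (pushforward h c) = pushforward h (bdry c).
Proof.
move=> hS hm hc; rewrite /pushforward -bdry_map_chain.
have hs := supp_map_chain hS hm hc.
rewrite -(normalize_bdry (weak_simplex_sorted hs)) [RHS]normalize_id //.
by apply: (@sorted_bdry S' n); apply: chain_on_normalize.
Qed.

(** The normalized prism bounds the difference: it is the homology form of the fact
    that comparable monotone maps are homotopic. *)
Lemma pushforward_homotopy (S S' : pred T) n (f g : T -> T) c :
  (forall x, S x -> S' (f x)) -> (forall x, S x -> S' (g x)) ->
  (forall x y, S x -> S y -> x <= y -> f x <= f y)%O ->
  (forall x y, S x -> S y -> x <= y -> g x <= g y)%O ->
  (forall x, S x -> f x <= g x)%O ->
  cycle_on S n c -> boundary_on S' n (pushforward g c - pushforward f c).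
Proof.
move=> hf hg mf mg fg [hc bc0].
have hp : supp (weak_simplex S' n.+1) (prism f g c).
  move: hc; apply: (supp_additive (f := prism f g)) => t /simplex_weak wt.
  exact: prism_supp wt.
exists (normalize (prism f g c)); first exact: chain_on_normalize.
have <- : normalize (bdry (normalize (prism f g c))) = bdry (normalize (prism f g c)).
  exact/normalize_id/(sorted_bdry (chain_on_normalize hp)).
by rewrite (normalize_bdry (weak_simplex_sorted hp)) bdry_prism bc0 raddf0 subr0 raddfB.
Qed.

Lemma pushforward_id S n h c :
  (forall x, S x -> h x = x) -> chain_on S n c -> pushforward h c = c.
Proof.
move=> hid; apply: (additive_ext (f := pushforward h) (g := idfun)) => t.
case/and3P=> st at_ _ /=; rewrite /pushforward map_chain_gen.
suff -> : map h t = t by rewrite normalize_gen st.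
by rewrite -[RHS]map_id; apply/eq_in_map => x /(allP at_) /hid.
Qed.

(** The homology of S at chains with n vertices is free with basis I, stated without
    forming a quotient: the coordinates f are a group morphism on cycles, onto, and
    their kernel consists of the boundaries. Outside cycles f is arbitrary. *)
Definition free_homology S n (I : finType) := exists f : chn -> {ffun I -> int},
  [/\ forall c e, cycle_on S n c -> cycle_on S n e -> f (c + e) = f c + f e,
      forall v, exists2 c, cycle_on S n c & f c = v
    & forall c, cycle_on S n c -> (f c = 0 <-> boundary_on S n c)].

Lemma boundary_cycle S n c : boundary_on S n c -> cycle_on S n c.
Proof. by case=> e he <-; split; [apply: chain_on_bdry | apply: bdryK]. Qed.

Lemma cycle_onD S n c e : cycle_on S n c -> cycle_on S n e -> cycle_on S n (c + e).
Proof. by move=> [h1 b1] [h2 b2]; split; [apply: suppD | rewrite raddfD /= b1 b2 addr0]. Qed.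

Lemma cycle_onN S n c : cycle_on S n c -> cycle_on S n (- c).
Proof. by move=> [h1 b1]; split; [apply: suppN | rewrite raddfN /= b1 oppr0]. Qed.

Lemma cycle_on0 S n : cycle_on S n 0.
Proof. by split; [apply: supp0 | rewrite raddf0]. Qed.

Lemma boundary_onD S n c e : boundary_on S n c -> boundary_on S n e -> boundary_on S n (c + e).
Proof. by move=> [b hb <-] [a ha <-]; exists (b + a); [apply: suppD | rewrite raddfD]. Qed.

Lemma boundary_onN S n c : boundary_on S n c -> boundary_on S n (- c).
Proof. by move=> [b hb <-]; exists (- b); [apply: suppN | rewrite raddfN]. Qed.

Lemma eq_mod_boundary S n (I : finType) (f : chn -> {ffun I -> int}) c e :
  (forall c e, cycle_on S n c -> cycle_on S n e -> f (c + e) = f c + f e) ->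
  (forall c, cycle_on S n c -> (f c = 0 <-> boundary_on S n c)) ->
  cycle_on S n c -> cycle_on S n e -> boundary_on S n (c - e) -> f c = f e.
Proof.
move=> fD fB hc he hb; rewrite -[c](subrK e) fD //; last exact: boundary_cycle.
by rewrite (fB _ (boundary_cycle hb)).2 // add0r.
Qed.

(** Coordinates on S' are pulled back along phi, while psi supplies cycles with given
    coordinates: phi and psi are mutually inverse in homology. *)
Lemma free_homology_transfer (S S' : pred T) n (I : finType) (phi psi : {additive chn -> chn}) :
  (forall c, cycle_on S n c -> cycle_on S' n (phi c)) ->
  (forall c, boundary_on S n c -> boundary_on S' n (phi c)) ->
  (forall c, cycle_on S' n c -> cycle_on S n (psi c)) ->
  (forall c, boundary_on S' n c -> boundary_on S n (psi c)) ->
  (forall c, cycle_on S n c -> boundary_on S n (psi (phi c) - c)) ->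
  (forall c, cycle_on S' n c -> boundary_on S' n (phi (psi c) - c)) ->
  free_homology S' n I -> free_homology S n I.
Proof.
move=> Zphi Bphi Zpsi Bpsi psiphi phipsi [f [fD fS fB]].
exists (f \o phi); split=> [c e hc he|v|c hc] /=.
- by rewrite raddfD fD //; apply: Zphi.
- have [c hc <-] := fS v; exists (psi c); first exact: Zpsi.
  by apply: eq_mod_boundary (phipsi _ hc) => //; apply/Zphi/Zpsi.
rewrite fB; last exact: Zphi.
split=> [|/Bphi//] /Bpsi h.
by rewrite -[c](subKr (psi (phi c))); apply/(boundary_onD h)/boundary_onN/psiphi.
Qed.

Lemma sub_cycle_on (S S' : pred T) n c :
  (forall x, S x -> S' x) -> cycle_on S n c -> cycle_on S' n c.
Proof. by move=> h [hc bc]; split=> //; apply: sub_chain_on hc. Qed.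

Lemma sub_boundary_on (S S' : pred T) n c :
  (forall x, S x -> S' x) -> boundary_on S n c -> boundary_on S' n c.
Proof. by move=> h [b hb <-]; exists b => //; apply: sub_chain_on hb. Qed.

Section Retract.
Variables (S S' : pred T) (r : T -> T).
Hypothesis sS'S : forall x, S' x -> S x.
Hypothesis rS : forall x, S x -> S' (r x).
Hypothesis r_homo : forall x y, S x -> S y -> (x <= y -> r x <= r y)%O.
Hypothesis r_id : forall x, S' x -> r x = x.
Hypothesis r_cmp : (forall x, S x -> r x <= x)%O \/ (forall x, S x -> x <= r x)%O.

Lemma pushforward_retract n c : cycle_on S n c -> boundary_on S n (pushforward r c - c).
Proof.
move=> hc; have hid : pushforward id c = c by apply: pushforward_id hc.1.
have rS' x : S x -> S (r x) by move=> /rS /sS'S.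
case: r_cmp => h.
  rewrite -opprB; apply: boundary_onN.
  by have := pushforward_homotopy (g := id) rS' _ r_homo _ h hc; rewrite hid; apply.
by have := pushforward_homotopy (f := id) _ rS' _ r_homo h hc; rewrite hid; apply.
Qed.

Lemma cycle_on_retract n c : cycle_on S n c -> cycle_on S' n (pushforward r c).
Proof.
move=> [hc bc]; split; first exact: (chain_on_pushforward rS r_homo hc).
by rewrite (bdry_pushforward rS r_homo hc) bc raddf0.
Qed.

Lemma boundary_on_retract n c : boundary_on S n c -> boundary_on S' n (pushforward r c).
Proof.
move=> [b hb <-]; exists (pushforward r b).
  exact: (chain_on_pushforward rS r_homo hb).
by rewrite (bdry_pushforward rS r_homo hb).
Qed.

(** A monotone retraction that is comparable with the identity is homotopic to it, so
    that it and the inclusion of its image are inverse in homology. *)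
Lemma free_homology_retract n I : free_homology S n I <-> free_homology S' n I.
Proof.
split; [apply: (@free_homology_transfer _ _ _ _ idfun (pushforward r))
       |apply: (@free_homology_transfer _ _ _ _ (pushforward r) idfun)] => c /=;
  try by [apply: sub_cycle_on | apply: sub_boundary_on | apply: cycle_on_retract
         | apply: boundary_on_retract | apply: pushforward_retract].
- by case=> hc _; rewrite (pushforward_id r_id hc) subrr; exists 0; [apply: supp0 | rewrite raddf0].
- by case=> hc _; rewrite (pushforward_id r_id hc) subrr; exists 0; [apply: supp0 | rewrite raddf0].
Qed.

Lemma acyclic_retract n : acyclic_on S' n -> acyclic_on S n.
Proof.
move=> ac c hc; rewrite -[c](subKr (pushforward r c)).
apply/boundary_onD; last exact/boundary_onN/pushforward_retract.
by apply/(sub_boundary_on sS'S)/ac/cycle_on_retract.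
Qed.
End Retract.

(** The cone with apex m bounds any cycle; the simplices that contain m already
    become degenerate and disappear in the normalization. *)
Lemma acyclic_min (S : pred T) m n : S m ->
  (forall x, S x -> m <= x)%O -> acyclic_on S n.
Proof.
move=> Sm mS c [hc bc].
have hw : supp (weak_simplex S n.+1) (cone m c).
  apply: (@weak_simplex_cone S) => // [y Sy|]; first by rewrite Sy mS.
  by apply: sub_supp hc => t /simplex_weak.
exists (normalize (cone m c)); first exact: chain_on_normalize.
rewrite -[LHS]normalize_id; last exact: (sorted_bdry (chain_on_normalize hw)).
rewrite (normalize_bdry (weak_simplex_sorted hw)) bdry_cone bc raddf0 subr0.
exact: (normalize_id (chain_on_sorted hc)).
Qed.
End Sequences.
Arguments bdry {d T} c.
Arguments normalize {d T} c.

(** * Removal of an antichain of minimal elements *)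

Section MinimalElements.
Local Open Scope ring_scope.
Variables (d : Order.disp_t) (T : finPOrderType d).
Local Notation chn := (fchain (seq T)).
Implicit Types (c e : chn) (t u : seq T) (x y : T) (S : pred T) (n : nat).

Lemma free_homology_reindex S n (I J : finType) :
  #|I| = #|J| -> free_homology S n I -> free_homology S n J.
Proof.
move=> eIJ [f [fD fS fB]].
pose h (j : J) : I := enum_val (cast_ord (esym eIJ) (enum_rank j)).
pose g (i : I) : J := enum_val (cast_ord eIJ (enum_rank i)).
have hK : cancel h g by move=> j; rewrite /h /g enum_valK cast_ordKV enum_rankK.
have gK : cancel g h by move=> j; rewrite /h /g enum_valK cast_ordK enum_rankK.
exists (fun c => [ffun j => f c (h j)]); split=> [c e hc he|v|c hc].
- by apply/ffunP=> j; rewrite !ffunE fD // ffunE.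
- have [c hc fc] := fS [ffun i => v (g i)]; exists c => //.
  by apply/ffunP=> j; rewrite !ffunE fc ffunE hK.
rewrite -fB //; split=> [/ffunP h0|->]; apply/ffunP=> i.
  by have := h0 (g i); rewrite !ffunE gK.
by rewrite !ffunE.
Qed.

Lemma acyclic_free_homology S n (I : finType) :
  #|I| = 0 -> acyclic_on S n -> free_homology S n I.
Proof.
move=> I0 ac; exists (fun=> 0); split=> [c e _ _|v|c hc]; first by rewrite addr0.
  exists 0; first exact: cycle_on0.
  by apply/ffunP=> i; have := card0_eq I0 i; rewrite inE.
by split=> // _; apply: ac.
Qed.

Lemma chain_on_empty S n c : (forall x, ~~ S x) -> chain_on S n.+1 c -> c = 0.
Proof.
move=> S0; apply: (additive_ext (f := idfun) (g := \0)) => -[|x t] /and3P[] //= _.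
by rewrite (negPf (S0 x)).
Qed.

Lemma acyclic_empty S n : (forall x, ~~ S x) -> acyclic_on S n.+1.
Proof.
move=> S0 c [/(chain_on_empty S0) -> _]; exists 0; first exact: supp0.
exact: raddf0.
Qed.

Lemma chain_on0P S c : chain_on S 0 c -> c = gen [::] *~ coef [::] c.
Proof.
pose g (c : chn) : chn := gen [::] *~ coef [::] c.
have gz : zmod_morphism g by move=> a b; rewrite /g raddfB /= mulrzBr.
pose G := GRing.isZmodMorphism.Build _ _ g gz.
pose GG : {additive chn -> chn} := HB.pack g G.
apply: (additive_ext (f := idfun) (g := GG)) => -[|x t] /and3P[] // _ _ _.
by rewrite /= /g coef_gen eqxx.
Qed.

(** The empty poset behaves as a sphere of dimension -1, generated by the empty simplex. *)
Lemma free_homology_empty0 S (I : finType) :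
  (forall x, ~~ S x) -> #|I| = 1%N -> free_homology S 0 I.
Proof.
move=> S0 I1.
have nilC : chain_on S 0 (gen [::]) by apply: supp_gen.
exists (fun c => [ffun _ => coef [::] c]); split=> [c e _ _|v|c [hc bc]].
- by apply/ffunP=> i; rewrite !ffunE raddfD.
- have [i0 _] : exists i0 : I, true.
    by move/eqP: I1; case: (pickP I) => [i|/eq_card0 ->]; first by exists i.
  exists (gen [::] *~ v i0).
    by split; [apply: suppMz | rewrite raddfMz /= bdry_nil mul0rz].
  apply/ffunP=> i; rewrite ffunE raddfMz /= coef_gen eqxx intz.
  by rewrite (fintype_le1P (eq_leq I1) i i0).
split=> [/ffunP h|[e he <-]].
  exists 0; first exact: supp0.
  rewrite raddf0; apply/esym; rewrite (chain_on0P hc).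
  have [i0 _] : exists i0 : I, true.
    by move/eqP: I1; case: (pickP I) => [i|/eq_card0 ->]; first by exists i.
  by have := h i0; rewrite !ffunE => ->.
by rewrite (chain_on_empty S0 he) raddf0; apply/ffunP=> i; rewrite !ffunE raddf0.
Qed.

Lemma acyclic0 S x : S x -> acyclic_on S 0.
Proof.
move=> Sx c [/chain_on0P -> _]; exists (gen [:: x] *~ coef [::] c).
  by apply/suppMz/supp_gen; rewrite /simplex /= Sx.
by rewrite raddfMz /= bdry_cons bdry_nil raddf0 subr0.
Qed.

(** For a minimal x, [tail_at x c] is the part of c in the link of x, and
    [cone x (tail_at x c)] is the part of c in the star of x. *)
Definition tail_at x : chn -> chn :=
  lin (fun t => if t is y :: u then (if x == y then gen u else 0) else 0).
HB.instance Definition _ x := GRing.Additive.on (tail_at x).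
Lemma tail_at_nil x : tail_at x (gen [::]) = 0. Proof. exact: lin_gen. Qed.

Lemma tail_at_cons x y t : tail_at x (gen (y :: t)) = if x == y then gen t else 0.
Proof. exact: lin_gen. Qed.

Lemma tail_at_cone x y c : tail_at x (cone y c) = if x == y then c else 0.
Proof.
case: (eqVneq x y) => [<-|nxy].
  apply: (@additive_ext _ _ xpredT (tail_at x \o cone x) idfun) => // t _ /=.
  by rewrite cone_gen tail_at_cons eqxx.
apply: (@additive_ext _ _ xpredT (tail_at x \o cone y) \0) => // t _ /=.
by rewrite cone_gen tail_at_cons (negPf nxy).
Qed.

Section MinimalPart.
Variables (S : pred T) (B : {set T}).
Hypothesis sBS : {subset B <= S}.
Hypothesis minB : forall b x, b \in B -> S x -> ~~ (x < b)%O.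
Let S0 := [pred x | S x & x \notin B].
Let L b := [pred x | S x & (b < x)%O].
Variable n : nat.
Hypothesis acS0 : forall m, acyclic_on S0 m.

Lemma chain_on_tail_at b m c : b \in B -> chain_on S m.+1 c -> chain_on (L b) m (tail_at b c).
Proof.
move=> bB; apply: (supp_additive (f := tail_at b)) => -[|y t] //= ty.
rewrite tail_at_cons; case: eqP => [eby|_]; last exact: supp0.
move: ty => /and3P[]; rewrite sorted_ltP -eby => /andP[h1 h2] /= /andP[_ h3] h4.
apply: supp_gen; apply/and3P; split=> //; apply/allP=> z zt.
by apply/andP; split; [apply: (allP h3) | apply: (allP h1)].
Qed.

(** Simplices that do not start at b contribute nothing on either side: nothing lies
    below b, so b cannot become a first vertex when a vertex is deleted. The sign
    comes from the position of the deleted vertex. *)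
Lemma tail_at_bdry b m c : b \in B -> chain_on S m.+1 c ->
  tail_at b (bdry c) = - bdry (tail_at b c).
Proof.
move=> bB hc; apply/eqP; rewrite -addr_eq0; apply/eqP; move: hc.
apply: (additive_ext (f := (tail_at b \o bdry) \+ (bdry \o tail_at b)) (g := \0)).
move=> [|y t] /and3P[] //.
rewrite sorted_ltP => /andP[h1 _] /= /andP[Sy _] _.
rewrite bdry_cons raddfB /= tail_at_cone tail_at_cons.
have -> : tail_at b (gen t) = 0.
  case: t h1 => [|z t] /=; first by rewrite tail_at_nil.
  case/andP=> yz _; rewrite tail_at_cons; case: eqP => // ebz.
  by move: (minB bB Sy); rewrite ebz yz.
by rewrite sub0r; case: ifP => // _; rewrite ?addNr // !(raddf0, addr0).
Qed.

Lemma tail_at_above b m c : b \in B -> chain_on S0 m c -> tail_at b c = 0.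
Proof.
move=> bB; apply: (additive_ext (f := tail_at b) (g := \0)) => -[|y t] /and3P[] //=.
  by rewrite tail_at_nil.
move=> _ /andP[/andP[_ nyB] _] _; rewrite tail_at_cons; case: eqP => // eby.
by rewrite -eby bB in nyB.
Qed.

(** A simplex has at most one vertex in B, and then as its first vertex, because the
    elements of B are minimal. *)
Lemma chain_on_split m c : chain_on S m.+1 c ->
  chain_on S0 m.+1 (c - \sum_(b in B) cone b (tail_at b c)).
Proof.
pose g (c : chn) : chn := c - \sum_(b in B) cone b (tail_at b c).
have gz : zmod_morphism g.
  move=> a e; rewrite /g.
  under eq_bigr => b _ do rewrite !raddfB /=.
  by rewrite sumrB !opprB -!addrA; congr (_ + _); rewrite addrC -addrA addrCA.
pose G := GRing.isZmodMorphism.Build _ _ g gz.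
pose GG : {additive chn -> chn} := HB.pack g G.
apply: (supp_additive (f := GG)) => -[|y t] // sy; rewrite /= /g.
have [yB|nyB] := boolP (y \in B).
  rewrite (bigD1 y) //= tail_at_cons eqxx cone_gen big1 ?addr0 ?subrr; first exact: supp0.
  by move=> b /andP[_ nby]; rewrite tail_at_cons (negPf nby) raddf0.
rewrite big1 ?subr0; last first.
  move=> b bB; rewrite tail_at_cons; case: eqP => [eby|_]; last by rewrite raddf0.
  by rewrite -eby bB in nyB.
apply: supp_gen; move: sy => /and3P[h1 h2 h3]; apply/and3P; split=> //.
apply/allP => z zt; apply/andP; split; first exact: (allP h2).
apply/negP=> zB; move: zt; rewrite inE => /orP[/eqP ezy|zt].
  by rewrite -ezy zB in nyB.
move: h1 h2; rewrite sorted_ltP => /andP[/allP/(_ z zt) yz _] /= /andP[Sy _].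
by move: (minB zB Sy); rewrite yz.
Qed.

Lemma link_sub b x : b \in B -> L b x -> S0 x.
Proof.
move=> bB /andP[Sx bx]; apply/andP; split=> //; apply/negP=> xB.
by move: (minB xB (sBS bB)); rewrite bx.
Qed.

(** Up to homotopy, S is S0 with a cone attached over each link, that is, a wedge of
    suspensions of the links since S0 is acyclic. The coordinates of a cycle are
    those of its tails at the elements of B. To realize given cycles in the links,
    their sum is bounded in S0 by some e, and e is subtracted from the sum of the
    cones. Conversely, if all tails of a cycle bound, then adding boundaries of cones
    moves the cycle into S0, where it bounds. *)
Lemma free_homology_minimal (r : T -> nat) :
  (forall b, b \in B -> free_homology (L b) n 'I_(r b)) ->
  free_homology S n.+1 {b : {b | b \in B} & 'I_(r (val b))}.
Proof.
move=> hL.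
pose F (b : {b | b \in B}) := sval (cid (hL (val b) (valP b))).
have FD b c e : cycle_on (L (val b)) n c -> cycle_on (L (val b)) n e -> F b (c + e) = F b c + F b e.
  by move: c e; rewrite /F; case: cid => f [].
have FS b v : exists2 c, cycle_on (L (val b)) n c & F b c = v.
  by move: v; rewrite /F; case: cid => f [].
have FB b c : cycle_on (L (val b)) n c -> (F b c = 0 <-> boundary_on (L (val b)) n c).
  by move: c; rewrite /F; case: cid => f [].
clearbody F.
have tailZ b c : b \in B -> cycle_on S n.+1 c -> cycle_on (L b) n (tail_at b c).
  move=> bB [hc bc]; split; first exact: chain_on_tail_at.
  by apply: oppr_inj; rewrite -(tail_at_bdry bB hc) bc !raddf0.
pose ix b i := existT (fun b : {b | b \in B} => 'I_(r (val b))) b i.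
pose G c := [ffun i : {b : {b | b \in B} & 'I_(r (val b))} =>
                (F (tag i) (tail_at (val (tag i)) c) (tagged i) : int)].
exists G; split=> [c e hc he|v|c hc].
- apply/ffunP=> i; rewrite !ffunE raddfD /= FD ?ffunE //;
    by apply: tailZ => //; apply: valP.
- pose w (b : {b | b \in B}) := sval (cid2 (FS b [ffun i => v (ix b i)])).
  have wZ b : cycle_on (L (val b)) n (w b) by rewrite /w; case: cid2.
  have Fw b : F b (w b) = [ffun i => v (ix b i)] by rewrite /w; case: cid2.
  have ZS0 : cycle_on S0 n (\sum_(b : {b | b \in B}) w b).
    elim/big_ind: _ => [|x y|b _]; [exact: cycle_on0 | exact: cycle_onD |].
    by apply: sub_cycle_on (wZ b) => x; apply/link_sub/valP.
  have [e he be] := acS0 ZS0.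
  pose c := \sum_(b : {b | b \in B}) cone (val b) (w b) - e.
  have hc : chain_on S n.+1 c.
    apply: suppB; last by apply: sub_chain_on he => x /andP[].
    apply: supp_sum => b _; apply: (chain_on_cone _ _ (wZ b).1).
      exact/sBS/valP.
    by move=> y /andP[Sy by_]; rewrite Sy.
  exists c.
    split=> //; rewrite raddfB raddf_sum /= be -sumrB big1 // => b _.
    by rewrite bdry_cone (wZ b).2 raddf0 subr0 subrr.
  apply/ffunP=> -[b i]; rewrite ffunE /=.
  suff -> : tail_at (val b) c = w b by rewrite Fw ffunE.
  rewrite raddfB /= (tail_at_above (valP b) he) subr0 raddf_sum /= (bigD1 b) //= tail_at_cone eqxx.
  rewrite big1 ?addr0 // => a nab; rewrite tail_at_cone ifF //.
  by apply/negbTE; rewrite eq_sym.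
split=> [G0|[e he <-]]; last first.
  apply/ffunP=> -[b i]; rewrite !ffunE /= (tail_at_bdry (valP b) he).
  suff -> : F b (- bdry (tail_at (val b) e)) = 0 by rewrite ffunE.
  have hb : boundary_on (L (val b)) n (bdry (tail_at (val b) e)).
    by exists (tail_at (val b) e) => //; exact: chain_on_tail_at (valP b) he.
  by apply/FB; [apply/cycle_onN/boundary_cycle | apply: boundary_onN].
have tailB (b : {b | b \in B}) : boundary_on (L (val b)) n (tail_at (val b) c).
  apply/FB; first by apply: tailZ => //; apply: valP.
  by apply/ffunP=> i; move/ffunP/(_ (ix b i)): G0; rewrite !ffunE.
pose w b := sval (cid2 (tailB b)).
have wC b : chain_on (L (val b)) n.+1 (w b) by rewrite /w; case: cid2.
have bw b : bdry (w b) = tail_at (val b) c by rewrite /w; case: cid2.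
pose z := \sum_(b : {b | b \in B}) cone (val b) (w b).
have zC : chain_on S n.+2 z.
  apply: supp_sum => b _; apply: (chain_on_cone _ _ (wC b)); first exact/sBS/valP.
  by move=> y /andP[Sy by_]; rewrite Sy.
have hz : chain_on S0 n.+1 (c + bdry z).
  have -> : c + bdry z = c - \sum_(b in B) cone b (tail_at b c) + \sum_(b : {b | b \in B}) w b.
    rewrite /z raddf_sum /=.
    under eq_bigr => b _ do rewrite bdry_cone bw.
    rewrite sumrB addrA addrAC; congr (_ + _); congr (_ - _).
    by rewrite (big_sub (mem B)).
  apply: suppD; first exact: chain_on_split hc.1.
  by apply: supp_sum => b _; apply: sub_chain_on (wC b) => x; apply/link_sub/valP.
have [|e he be] := @acS0 n.+1 (c + bdry z).
  by split=> //; rewrite raddfD /= hc.2 bdryK addr0.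
exists (e - z); first by apply: suppB => //; apply: sub_chain_on he => x /andP[].
by rewrite raddfB /= be addrK.
Qed.

Lemma free_homology_minimal_card (r : T -> nat) (I : finType) :
  (forall b, b \in B -> free_homology (L b) n 'I_(r b)) ->
  #|I| = (\sum_(b in B) r b)%N -> free_homology S n.+1 I.
Proof.
move=> hL cI; apply: free_homology_reindex (free_homology_minimal hL).
rewrite card_tagged sumnE big_map big_enum /= cI.
under eq_bigr => b _ do rewrite card_ord.
by rewrite -(big_sub (mem B) (fun b => r b)).
Qed.
End MinimalPart.
End MinimalElements.

(** * Comparison with reduced homology *)

Section Conversion.
Local Open Scope ring_scope.
Variables (d : Order.disp_t) (T : finPOrderType d).
Local Notation chn := (fchain (seq T)).
Implicit Types n l : nat.

Definition to_fchain n (c : chains T n) : chn :=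
  \sum_(t : face T n) gen (val (val t)) *~ c t.
Definition of_fchain n (c : chn) : chains T n :=
  [ffun t : face T n => coef (val (val t)) c].

Lemma of_fchain_is_zmod_morphism n : zmod_morphism (@of_fchain n).
Proof. by move=> b c; apply/ffunP=> t; rewrite !ffunE raddfB. Qed.
HB.instance Definition _ n := GRing.isZmodMorphism.Build chn (chains T n)
  (@of_fchain n) (@of_fchain_is_zmod_morphism n).

Lemma to_fchain_is_zmod_morphism n : zmod_morphism (@to_fchain n).
Proof.
by move=> b c; rewrite -sumrB; apply: eq_bigr => t _; rewrite !ffunE mulrzBr.
Qed.
HB.instance Definition _ n := GRing.isZmodMorphism.Build (chains T n) chn
  (@to_fchain n) (@to_fchain_is_zmod_morphism n).

Lemma coef_to_fchain n (c : chains T n) (t : face T n) :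
  coef (val (val t)) (to_fchain c) = c t.
Proof.
rewrite raddf_sum /= (bigD1 t) //= raddfMz /= coef_gen eqxx intz.
rewrite big1 ?addr0 // => u nut; rewrite raddfMz /= coef_gen.
case: eqP => [e|_]; last by rewrite mul0rz.
by case/eqP: nut; apply/val_inj/val_inj.
Qed.

Lemma to_fchainK n : cancel (@to_fchain n) (@of_fchain n).
Proof. by move=> c; apply/ffunP=> t; rewrite ffunE coef_to_fchain. Qed.

Lemma chain_on_to_fchain n (c : chains T n) : chain_on xpredT n (to_fchain c).
Proof.
apply: supp_sum => t _; apply/suppMz/supp_gen/and3P; split.
- exact: (valP t).
- exact: all_predT.
by rewrite size_tuple.
Qed.

Lemma of_fchainK n (c : chn) : chain_on xpredT n c -> to_fchain (@of_fchain n c) = c.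
Proof.
apply: (additive_ext (f := @to_fchain n \o @of_fchain n) (g := idfun)).
move=> t /and3P[st _ sz] /=.
pose f : face T n := exist _ (Tuple sz) st.
rewrite /to_fchain (bigD1 f) //= ffunE coef_gen eqxx mulr1z.
rewrite big1 ?addr0 // => u nuf; rewrite ffunE coef_gen.
case: eqP => [e|_]; last by rewrite mulr0z.
by case/eqP: nuf; apply/val_inj/val_inj.
Qed.

Lemma bdry_genE (t : seq T) :
  bdry (gen t) = \sum_(i < size t) gen (take i t ++ drop i.+1 t) *~ (-1) ^+ i.
Proof.
elim: t => [|x t IH]; first by rewrite bdry_nil big_ord0.
rewrite bdry_cons IH big_ord_recl /= expr0 mulr1z drop0 raddf_sum /= -sumrN.
congr (_ + _); apply: eq_bigr => i _.
by rewrite raddfMz /= cone_gen exprS mulN1r mulrNz.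
Qed.

Lemma val_del_vertex n (t : n.+1.-tuple T) (i : 'I_n.+1) :
  val (del_vertex t i) = take i t ++ drop i.+1 t.
Proof.
have x0 := thead t.
apply: (@eq_from_nth _ x0) => [|k].
  rewrite size_tuple size_cat size_drop size_takel ?size_tuple 1?ltnW //.
  by have := ltn_ord i; lia.
rewrite size_tuple => kn.
have := tnth_nth x0 (del_vertex t i) (Ordinal kn); rewrite tnth_mktuple /= => <-.
rewrite (tnth_nth x0) /= nth_cat size_takel; last first.
  by rewrite size_tuple; apply/ltnW/ltn_ord.
rewrite /bump; have [ki|ki] := ltnP k i; first by rewrite nth_take.
by rewrite nth_drop; congr nth; lia.
Qed.

Lemma of_fchain_bdry n (c : chn) :
  chain_on xpredT n.+1 c -> of_fchain n (bdry c) = boundary (of_fchain n.+1 c).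
Proof.
apply: (additive_ext (f := @of_fchain n \o bdry) (g := @boundary d T n \o @of_fchain n.+1)).
move=> t /and3P[st _ sz] /=.
apply/ffunP=> s; rewrite !ffunE bdry_genE raddf_sum /=.
pose f : face T n.+1 := exist _ (Tuple sz) st.
rewrite [RHS](bigD1 f) //= [X in _ = _ + X]big1 ?addr0; last first.
  move=> u nuf; apply: big1 => i _; rewrite ffunE coef_gen.
  case: eqP => [e|_]; last by rewrite mulr0.
  by case/eqP: nuf; apply/val_inj/val_inj.
rewrite [RHS]big_mkcond /= (eqP sz); apply: eq_bigr => i _.
rewrite ffunE coef_gen eqxx raddfMz /= coef_gen mulr1 -(inj_eq val_inj) val_del_vertex /= eq_sym.
by case: eqP; rewrite ?mul0rz // intz.
Qed.

(** The coordinates are constant on homology classes, hence define a map on the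
    quotient through representatives, which is injective and onto. *)
Lemma free_homology_isog l k (I : finType) : #|I| = k ->
  free_homology (T := T) xpredT l.+1 I -> zmod_isog (reduced_homology T l) 'rV[int]_k.
Proof.
move=> <- {k} [f [fD fS fB]].
have Zcyc (z : cycles T l) : cycle_on (T := T) xpredT l.+1 (to_fchain (val z)).
  split; first exact: chain_on_to_fchain.
  have h : chain_on xpredT l.+1 _ := @chain_on_to_fchain _ (val z).
  rewrite -(of_fchainK (chain_on_bdry h)) of_fchain_bdry // to_fchainK.
  by case: z {h} => z /= /eqP ->; rewrite raddf0.
have BP (z : cycles T l) : reflect (boundary_on (T := T) xpredT l.+1 (to_fchain (val z)))
    (z \in @is_boundary d T l).
  apply: (iffP (asboolP _)) => [[b bz]|[e he ez]].
    exists (to_fchain b); first exact: chain_on_to_fchain.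
    have h : chain_on xpredT l.+2 _ := @chain_on_to_fchain _ b.
    by rewrite -(of_fchainK (chain_on_bdry h)) of_fchain_bdry // to_fchainK bz.
  by exists (of_fchain l.+2 e); rewrite -of_fchain_bdry // ez to_fchainK.
pose h (z : cycles T l) : 'rV[int]_#|I| := \row_i f (to_fchain (val z)) (enum_val i).
have hD : {morph h : x y / x + y}.
  by move=> x y; apply/rowP=> i; rewrite !mxE !raddfD /= (fD _ _ (Zcyc x) (Zcyc y)) ffunE.
have h0P z : h z = 0 <-> z \in @is_boundary d T l.
  have := fB _ (Zcyc z) => fz; split=> [/rowP hz|/BP/fz fz0].
    apply/BP/fz/ffunP=> i; have := hz (enum_rank i).
    by rewrite !mxE enum_rankK ffunE.
  by apply/rowP=> i; rewrite !mxE fz0 ffunE.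
have h0 : h 0 = 0 by apply/h0P; apply: rpred0.
have hN : {morph h : x / - x}.
  by move=> x; apply: (addrI (h x)); rewrite -hD !subrr.
have h_eq x y : h x = h y <-> x - y \in @is_boundary d T l.
  rewrite -h0P hD hN; split=> [->|/eqP]; first by rewrite subrr.
  by rewrite subr_eq0 => /eqP.
pose g (q : reduced_homology T l) := h (generic_quotient.repr q).
have gpi (z : cycles T l) : g (\pi_(reduced_homology T l) z)%qT = h z.
  by apply/h_eq; rewrite ring_quotient.Quotient.idealrBE generic_quotient.reprK eqxx.
have gD : zmod_morphism g.
  elim/quotP=> x _; elim/quotP=> y _.
  by rewrite -[_ - _]raddfB !gpi hD hN.
pose G := GRing.isZmodMorphism.Build _ _ g gD.
pose GG : {additive reduced_homology T l -> 'rV[int]_#|I|} := HB.pack g G.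
exists GG; rewrite /=.
have gS (v : 'rV[int]_#|I|) : exists q, g q = v.
  have [c [hc bc] fc] := fS [ffun i => v 0 (enum_rank i)].
  have zc : of_fchain l.+1 c \in @is_cycle d T l.
    by rewrite inE -of_fchain_bdry // bc raddf0.
  exists (\pi_(reduced_homology T l) (Cycle zc))%qT.
  by rewrite gpi; apply/rowP=> i; rewrite mxE /= of_fchainK // fc ffunE enum_valK.
pose g' v := sval (cid (gS v)).
have g'K : cancel g' g by move=> v; rewrite /g'; case: cid.
exists g' => // q; have := g'K (g q).
elim/quotP: q => x _; elim/quotP: (g' _) => y _.
rewrite !gpi => /h_eq; rewrite ring_quotient.Quotient.idealrBE => /eqP exy; exact: exy.
Qed.
End Conversion.

(** * Subgroups of order p^2 over a central subgroup of order p *)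

Section GroupLemmas.
Import GroupScope.

Lemma mem_Ohm1 (gT : finGroupType) (p : nat) (G : {group gT}) x :
  p.-group G -> x \in G -> x ^+ p = 1 -> x \in 'Ohm_1(G).
Proof. by move=> pG Gx xp; rewrite (OhmE 1 pG) mem_gen // !inE Gx expn1 xp /=. Qed.

Lemma exponent_sub_Ohm1 (gT : finGroupType) (p : nat) (G H : {group gT}) :
  p.-group G -> H \subset G -> exponent H %| p -> H \subset 'Ohm_1(G).
Proof.
move=> pG sHG /exponentP eH; apply/subsetP=> x Hx.
by apply: (mem_Ohm1 pG); [apply: (subsetP sHG) | apply: eH].
Qed.

Lemma abelemY (gT : finGroupType) (p : nat) (A B : {group gT}) :
  p.-abelem A -> p.-abelem B -> B \subset 'C(A) -> p.-abelem (A <*> B).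
Proof. by move=> hA hB cAB; rewrite (cprod_abelem p (cprodEY cAB)) hA hB. Qed.

End GroupLemmas.

Section PrimeCentral.
Import GroupScope.
Variables (gT : finGroupType) (p : nat) (P Z : {group gT}).
Hypotheses (p_pr : prime p) (p_odd : odd p) (pP : p.-group P).
Hypotheses (oZ : #|Z| = p) (sZ : Z \subset 'Z(P)).
Implicit Types (E F G H K M Q X Y : {group gT}) (n : nat).

Let p_gt1 := prime_gt1 p_pr.
Let p_gt0 := prime_gt0 p_pr.

Lemma pgroup_le G : G \subset P -> p.-group G.
Proof. by move/pgroupS; apply. Qed.

Lemma centZ G : G \subset P -> G \subset 'C(Z).
Proof.
move=> sGP; apply: subset_trans sGP _; rewrite centsC.
by apply: subset_trans sZ _; apply: subsetIr.
Qed.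

Lemma normZ G : G \subset P -> G \subset 'N(Z).
Proof. by move=> /centZ; apply: cents_norm. Qed.

Lemma abelemZ : p.-abelem Z.
Proof. by apply: prime_abelem. Qed.

Lemma proper_card_ge G : p.-group G -> Z \proper G -> (p ^ 2)%N <= #|G|.
Proof.
move=> pG /proper_card; rewrite oZ (card_pgroup pG) -{1}(expn1 p).
by rewrite ltn_exp2l // leq_exp2l.
Qed.

Lemma eq_rank2 K F : #|F| = (p ^ 2)%N -> Z \proper K -> K \subset F -> K :=: F.
Proof.
move=> oF ltZK sKF; apply/eqP; rewrite eqEcard sKF oF.
apply: proper_card_ge => //; apply: pgroupS sKF _.
by rewrite /pgroup oF pnatX pnat_id.
Qed.

Lemma rank2_gen F f : #|F| = (p ^ 2)%N -> Z \subset F -> f \in F :\: Z ->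
  <[f]> <*> Z = F.
Proof.
move=> oF sZF /setDP[Ff nZf]; apply: (@eq_rank2 (<[f]> <*> Z)%G) => //.
  rewrite properE joing_subr; apply: contra nZf; rewrite join_subG.
  by rewrite cycle_subG => /andP[].
by rewrite join_subG cycle_subG Ff.
Qed.

(** As F = <f> Z with Z central, H centralizes F exactly when it centralizes f. The
    conjugates of f under H lie in the coset f Z, so their number is a power of p
    between 2 and p. *)
Lemma card_cent_rank2 F H : H \subset P -> #|F| = (p ^ 2)%N -> Z \subset F ->
  [~: F, H] \subset Z -> ~~ (H \subset 'C(F)) -> (#|H| = p * #|'C_H(F)|)%N.
Proof.
move=> sHP oF sZF cFH ncFH.
have [f FDf] : exists f, f \in F :\: Z.
  apply/set0Pn; rewrite setD_eq0; apply/negP=> /subset_leq_card.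
  by rewrite oF oZ -{2}(expn1 p) leq_exp2l.
have [Ff nZf] := setDP FDf.
have eC : 'C_H(F) = 'C_H[f].
  rewrite -(rank2_gen oF sZF FDf) centY cent_cycle setIA; apply/setIidPl.
  by apply: subset_trans (centZ sHP); apply: subsetIl.
have le_p : #|f ^: H| <= p.
  rewrite -oZ -(card_lcoset Z f); apply/subset_leq_card/subsetP=> _ /imsetP[h Hh ->].
  rewrite mem_lcoset; apply: (subsetP cFH); exact: mem_commg.
have pI : p.-nat #|f ^: H|.
  rewrite -index_cent1; apply: pnat_dvd (dvdn_indexg _ _) _.
  exact: (pgroup_le sHP).
rewrite -(Lagrange (subsetIl H 'C(F))) mulnC; congr (_ * _)%N.
rewrite /= eC index_cent1; case: (p_natP pI) => k ek; rewrite ek in le_p *.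
case: k => [|[|k]] in ek le_p *.
- have e1 : #|H : 'C_H(F)| = 1%N by rewrite /= eC index_cent1 ek.
  by case/negP: ncFH; apply/setIidPl/index1g/e1/subsetIl.
- by rewrite expn1.
by move: le_p; rewrite -{2}(expn1 p) leq_exp2l.
Qed.

(** As p is odd, a maximal normal elementary abelian subgroup A of Q satisfies
    Ohm_1(C_Q(A)) = A. It contains Z, and differs from Z because otherwise E would lie
    in Ohm_1(C_Q(Z)) = Z. Hence A contains a normal subgroup of Q of order p^2, and
    that subgroup meets the center of Q nontrivially inside Ohm_1(Z(Q)) = Z, which has
    prime order, so it contains Z. *)
Lemma exists_normal_rank2 Q E : Q \subset P -> Z \subset Q ->
    'Ohm_1('Z(Q)) = Z -> E \subset Q -> p.-abelem E -> Z \proper E ->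
  exists E0 : {group gT}, [/\ E0 <| Q, p.-abelem E0, #|E0| = (p ^ 2)%N & Z \subset E0].
Proof.
move=> sQP sZQ OZ sEQ abE ltZE; have pQ := pgroup_le sQP.
have [|A maxA] := @ex_maxgroup gT [pred A : {group gT} | (A <| Q) && p.-abelem A].
  by exists 1%G; rewrite /= normal1 abelem1.
have /andP[nAQ abA] := maxgroupp maxA.
have OA := Ohm1_cent_max_normal_abelem p_odd pQ maxA.
have pC : p.-group 'C_Q(A) by apply: pgroupS pQ; apply: subsetIl.
have sZA : Z \subset A.
  rewrite -OA; apply: (exponent_sub_Ohm1 pC); last first.
    by move: abelemZ; rewrite abelemE // => /andP[].
  by rewrite subsetI sZQ centsC centZ // (subset_trans (normal_sub nAQ)).
have A2 : 2 <= logn p #|A|.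
  rewrite -(leq_exp2l _ _ p_gt1) -card_pgroup ?(abelem_pgroup abA) //.
  apply: proper_card_ge; first exact: abelem_pgroup abA.
  rewrite properEneq sZA andbT; apply/eqP=> eZA.
  move: (ltZE); rewrite properE => /andP[_ /negP[]]; rewrite eZA -OA.
  apply: (exponent_sub_Ohm1 pC); last first.
    by move: abE; rewrite abelemE // => /andP[].
  by rewrite subsetI sEQ -eZA centZ // (subset_trans sEQ).
have [L [sLA nLQ oL]] := normal_pgroup pQ nAQ A2.
have abL := abelemS sLA abA.
exists L; split=> //; apply: prime_meetG; first by rewrite oZ.
have ntL : L :!=: 1 by rewrite -cardG_gt1 oL (leq_trans p_gt1) // -{1}(expn1 p) leq_exp2l.
apply: contra (meet_center_nil (pgroup_nil pQ) nLQ ntL) => /eqP ZL1.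
rewrite -subG1 -ZL1 subsetI subsetIl andbT.
suff: L :&: 'Z(Q) \subset 'Ohm_1('Z(Q)) by rewrite OZ.
apply: (@exponent_sub_Ohm1 _ p [group of 'Z(Q)] [group of L :&: 'Z(Q)]).
- by apply: pgroupS pQ; apply: center_sub.
- exact: subsetIr.
have := abelemS (subsetIl L 'Z(Q)) abL.
by rewrite abelemE // => /andP[].
Qed.

Lemma rank2_of_elt x : x \in P -> x ^+ p = 1 -> x \notin Z ->
  p.-abelem (<[x]> <*> Z) /\ #|<[x]> <*> Z| = (p ^ 2)%N.
Proof.
move=> Px xp nZx; have x1 : x != 1 by apply: contraNneq nZx => ->.
have ox : #[x] = p.
  by apply/(prime_nt_dvdP p_pr); rewrite ?order_eq1 // order_dvdn xp.
have cxZ : Z \subset 'C(<[x]>).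
  by rewrite centsC cycle_subG (subsetP (centZ (subxx P))).
split.
  apply: abelemY => //; last exact: abelemZ.
  by apply: prime_abelem => //; rewrite -orderE.
rewrite /= cent_joinEr // TI_cardMg -?orderE ?ox ?oZ //.
by apply: prime_TIg; rewrite -?orderE ?ox // cycle_subG.
Qed.

(** * Extraspecial subgroups with small centralizer *)

(** For n > 0 these turn out to be the subgroups to be counted, all of which have
    center Z, see [counted_center] and [card_extraspecial]. For n = 0 the only
    candidate is Z, so that the count is 1 when the poset is empty: this makes the
    recursion [sum_card_counted] start in dimension -1. *)
Definition counted n Q X := [&& Z \subset X, X \subset Q, exponent X %| p,
   X^`(1) \subset Z, #|X| == (p ^ n.*2.+1)%N & 'Ohm_1('C_Q(X)) == Z].

Lemma counted_cent n Q X x : Q \subset P -> counted n Q X ->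
  x \in Q -> x \in 'C(X) -> x ^+ p = 1 -> x \in Z.
Proof.
move=> sQP /and5P[_ _ _ _ /andP[_ /eqP <-]] Qx Cx xp.
have pC : p.-group ('C_Q(X)) by apply/pgroup_le; rewrite subIset ?sQP.
by apply: (mem_Ohm1 pC) => //; rewrite inE Qx.
Qed.

Lemma counted_center n Q X : Q \subset P -> counted n Q X -> 'Z(X) = Z.
Proof.
move=> sQP gX; have /and5P[sZX sXQ /exponentP eX _ /andP[_ _]] := gX.
apply/eqP; rewrite eqEsubset subsetI sZX centsC centZ ?(subset_trans sXQ) // !andbT.
apply/subsetP=> x /setIP[Xx Cx].
by apply: (counted_cent sQP gX) => //; [apply: (subsetP sXQ) | apply: eX].
Qed.

Lemma counted_pextraspecial n Q X : Q \subset P -> counted n.+1 Q X -> pextraspecial p X.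
Proof.
move=> sQP gX; have /and5P[sZX sXQ /exponentP eX dX /andP[/eqP oX _]] := gX.
rewrite /pextraspecial (counted_center sQP gX) oZ eqxx /=; apply/andP; split.
  apply/abelemP => //; split; first exact: sub_der1_abelian.
  move=> _ /morphimP[x Nx Xx ->]; rewrite -morphX //= eX //; exact: morph1.
rewrite -subG1 quotient_sub1; last by apply/normZ/(subset_trans sXQ).
apply/negP=> /subset_leq_card; rewrite oX oZ -{2}(expn1 p) leq_exp2l //.
Qed.

Section Step.
Variables (Q E0 : {group gT}).
Hypotheses (sQP : Q \subset P) (sZQ : Z \subset Q) (OZ : 'Ohm_1('Z(Q)) = Z).
Hypotheses (nE0 : E0 <| Q) (abE0 : p.-abelem E0) (oE0 : #|E0| = (p ^ 2)%N).
Hypothesis sZE0 : Z \subset E0.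
Let M := 'C_Q(E0).

(** E0 / Z is normal of order p in the p-group Q / Z, hence central. *)
Lemma commE0Q : [~: E0, Q] \subset Z.
Proof.
have sE0Q := normal_sub nE0.
rewrite -quotient_cents2; try by apply/normZ/subset_trans/sQP.
have pQZ : p.-group (Q / Z) by apply/quotient_pgroup/pgroup_le.
have oE0Z : #|E0 / Z| = p.
  rewrite card_quotient; last by apply/normZ/(subset_trans sE0Q).
  by rewrite -divgS // oE0 oZ mulnK.
have nEQ : E0 / Z <| Q / Z by apply: quotient_normal.
have sEZ : E0 / Z \subset 'Z(Q / Z).
  apply: prime_meetG; first by rewrite oE0Z.
  apply: meet_center_nil nEQ _; first exact: pgroup_nil pQZ.
  by rewrite -cardG_gt1 oE0Z.
by apply: subset_trans sEZ _; apply: subsetIr.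
Qed.

Lemma ncQE0 : ~~ (Q \subset 'C(E0)).
Proof.
apply/negP=> cQE0; have sEZ : E0 \subset Z.
  suff: E0 \subset 'Ohm_1('Z(Q)) by rewrite OZ.
  apply: (@exponent_sub_Ohm1 _ p [group of 'Z(Q)] E0).
  - by apply/pgroup_le/(subset_trans (center_sub Q)).
  - by rewrite subsetI normal_sub // centsC.
  by move: abE0; rewrite abelemE // => /andP[].
by have := subset_leq_card sEZ; rewrite oE0 oZ -{2}(expn1 p) leq_exp2l.
Qed.

Lemma cardQM : (#|Q| = p * #|M|)%N.
Proof. exact: card_cent_rank2 sQP oE0 sZE0 commE0Q ncQE0. Qed.

Lemma sMQ : M \subset Q. Proof. exact: subsetIl. Qed.

Lemma sE0M : E0 \subset M.
Proof. by rewrite subsetI normal_sub //= -abelianE; case/andP: abE0 => _ /andP[]. Qed.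

Lemma sZM : Z \subset M. Proof. exact: subset_trans sZE0 sE0M. Qed.

(** An element e of E0 acts on X by commutators with values in Z. Since X is
    extraspecial, some x in X acts in the same way, that is, e = x c with c in the
    centralizer of X; then c^p = 1, whence c is in Z and e in X. *)
Lemma counted_E0 n X : counted n.+1 Q X -> E0 \subset X.
Proof.
move=> gX; have /and5P[sZX sXQ /exponentP eX dX /andP[/eqP oX _]] := gX.
have sXP := subset_trans sXQ sQP; have sE0Q := normal_sub nE0.
have sRP : X <*> E0 \subset P by rewrite join_subG sXP (subset_trans sE0Q).
have pX := pgroup_le sXP; have pR := pgroup_le sRP.
have esX : extraspecial X.
  by apply/(pextraspecialP p_pr pX)/(counted_pextraspecial sQP gX).
have dXE : X^`(1) = Z by case: esX => [[_ ->] _]; apply: counted_center gX.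
have cXR : [~: X, X <*> E0] \subset X^`(1).
  have nXZ := normZ sXP; have nEZ := normZ (subset_trans sE0Q sQP).
  rewrite dXE -quotient_cents2 ?normZ // quotientY // centY subsetI.
  rewrite !quotient_cents2 // dX commGC.
  by apply: subset_trans commE0Q; apply: commgS.
have crit := critical_extraspecial pR (joing_subl X E0) esX cXR.
apply/subsetP=> e E0e.
have : e \in X * 'C_(X <*> E0)(X).
  have [_ eR _] := cprodP crit.
  by rewrite eR (subsetP (joing_subr X E0)).
case/mulsgP=> x c Xx /setIP[Rc Cc] ee.
have cxc : commute x c by apply/esym/(centP Cc).
have Qc : c \in Q.
  by apply: (subsetP _ c Rc); rewrite join_subG sXQ sE0Q.
rewrite ee groupM //; apply: (subsetP sZX); apply: (counted_cent sQP gX) => //.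
have [_ eE0] := elimT (abelemP p_pr) abE0.
have := eE0 _ E0e; rewrite ee expgMn // eX // mul1g //.
Qed.

(** Among the elementary abelian subgroups of order p^2 over Z, those that meet M
    in Z are those that do not commute with E0. *)
Definition off_line F := [&& F \subset Q, p.-abelem F, Z \subset F, #|F| == (p ^ 2)%N
  & F :&: M == Z].

(** M has index p in Q, so E meets M in index at most p. *)
Lemma off_line_of_meet E : E \subset Q -> p.-abelem E -> (p ^ 2 <= #|E|)%N ->
  E :&: M = Z -> off_line E.
Proof.
move=> sEQ abE geE EM; apply/and5P; split=> //; last by rewrite EM.
  by rewrite -EM subsetIl.
rewrite eqn_leq geE andbT -(leq_pmul2r (cardG_gt0 [group of M])) mul_cardG EM oZ.
by rewrite mulnC expnS expn1 -mulnA -cardQM leq_mul2l subset_leq_card ?orbT // mul_subG ?sMQ.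
Qed.

Section OneF.
Variable F : {group gT}.
Hypothesis hF : off_line F.
Let sFQ : F \subset Q. Proof. by case/and5P: hF. Qed.
Let abF : p.-abelem F. Proof. by case/and5P: hF. Qed.
Let sZF : Z \subset F. Proof. by case/and5P: hF. Qed.
Let oF : #|F| = (p ^ 2)%N. Proof. by case/and5P: hF => _ _ _ /eqP. Qed.
Let FM : F :&: M = Z. Proof. by case/and5P: hF => _ _ _ _ /eqP. Qed.
Let sE0Q : E0 \subset Q := normal_sub nE0.
Let nZQ G : G \subset Q -> G \subset 'N(Z).
Proof. by move=> sGQ; apply/normZ/(subset_trans sGQ). Qed.

Lemma card_rank2_Z : (#|Z| < p ^ 2)%N.
Proof. by rewrite oZ -{1}(expn1 p) ltn_exp2l. Qed.

Lemma off_line_ncent : ~~ (F \subset 'C(E0)).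
Proof.
apply/negP=> cFE0; have := card_rank2_Z; rewrite -oF -FM.
by rewrite (setIidPl _) ?ltnn // subsetI sFQ.
Qed.

Lemma off_line_E0_cent : E0 :&: 'C(F) = Z.
Proof.
apply/eqP; rewrite eqEsubset subsetI sZE0 (centsC Z) (centZ (subset_trans sFQ sQP)) !andbT.
apply/negPn/negP=> nsub; case/negP: off_line_ncent; rewrite centsC.
have pr : Z \proper E0 :&: 'C(F).
  by rewrite properE nsub subsetI sZE0 (centsC Z) (centZ (subset_trans sFQ sQP)).
have <- := @eq_rank2 [group of E0 :&: 'C(F)] E0 oE0 pr (subsetIl _ _).
exact: subsetIr.
Qed.

Lemma off_line_E0_meet : E0 :&: F = Z.
Proof.
apply/eqP; rewrite eqEsubset subsetI sZE0 sZF !andbT -FM setIC.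
exact: setIS sE0M.
Qed.

Lemma off_line_joing : E0 <*> F = E0 * F.
Proof. by apply: norm_joinEr; apply: subset_trans sFQ (normal_norm nE0). Qed.

Lemma card_off_line_joing : #|E0 <*> F| = (p ^ 3)%N.
Proof.
have := mul_cardG E0 F; rewrite off_line_E0_meet oE0 oF oZ off_line_joing => e.
by apply/eqP; rewrite -(eqn_pmul2r p_gt0) -e -expnD -expnSr.
Qed.

Lemma off_line_joing_cent : (E0 <*> F) :&: 'C_M(F) = Z.
Proof.
rewrite off_line_joing setIA -group_modl ?sE0M // FM (mulGSid sZE0).
exact: off_line_E0_cent.
Qed.

Lemma sCMFQ : 'C_M(F) \subset Q.
Proof. by apply: subset_trans sMQ; apply: subsetIl. Qed.

Lemma cent_joing3 Y : 'C_Q(E0 <*> F <*> Y) = 'C_('C_M(F))(Y).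
Proof. by rewrite !centY !setIA. Qed.

(** X = E0 F Y is the central product of Y with E0 F, which is extraspecial of order
    p^3; and the centralizer of X in Q is that of Y in C_M(F). *)
Lemma counted_extend n Y : counted n [group of 'C_M(F)] Y ->
  counted n.+1 Q [group of E0 <*> F <*> Y].
Proof.
move=> gY; have /and5P[sZY sYC eY dY /andP[/eqP oY OY]] := gY.
have sYQ := subset_trans sYC sCMFQ.
have cYE0 : Y \subset 'C(E0).
  by rewrite (subset_trans sYC) // (subset_trans (subsetIl _ _)) // subsetIr.
have cYF : Y \subset 'C(F) by rewrite (subset_trans sYC) // subsetIr.
have cYG : Y \subset 'C(E0 <*> F) by rewrite centY subsetI cYE0.
set X := [group of _].
have sXQ : X \subset Q by rewrite !join_subG sE0Q sFQ.
have sZX : Z \subset X by rewrite (subset_trans sZY) // joing_subr.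
have pX := pgroup_le (subset_trans sXQ sQP).
have dX : X^`(1) \subset Z.
  apply: der1_min; first exact: nZQ.
  rewrite /X /= !quotientY ?nZQ //; last by rewrite join_subG sE0Q.
  have aE0 := quotient_abelian Z (abelem_abelian abE0).
  have aF := quotient_abelian Z (abelem_abelian abF).
  rewrite !abelianY aE0 aF (sub_der1_abelian dY) /=; apply/andP; split.
    rewrite quotient_cents2 ?nZQ // commGC.
    by apply: subset_trans commE0Q; apply: commgS.
  by rewrite -quotientY ?nZQ // quotient_cents.
apply/and5P; split=> //; last (apply/andP; split).
- have sXO : X \subset 'Ohm_1(X).
    have sub G : G \subset X -> exponent G %| p -> G \subset 'Ohm_1(X).
      exact: exponent_sub_Ohm1.
    rewrite {1}/X /= !join_subG; apply/andP; split; last by apply: sub => //; apply: joing_subr.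
    apply/andP; split.
      apply: sub; last by move: abE0; rewrite abelemE // => /andP[].
      by rewrite (subset_trans (joing_subl _ F)) // joing_subl.
    apply: sub; last by move: abF; rewrite abelemE // => /andP[].
    by rewrite (subset_trans (joing_subr E0 _)) // joing_subl.
  apply: dvdn_trans (exponentS sXO) _; apply: exponent_Ohm1_class2 => //.
  rewrite nil_class2 (subset_trans dX) // subsetI sZX centsC.
  exact/centZ/subset_trans/sQP.
- have GY : (E0 <*> F) :&: Y = Z.
    apply/eqP; rewrite eqEsubset subsetI sZY (subset_trans sZF (joing_subr _ _)) !andbT.
    by rewrite -off_line_joing_cent setIS.
  have := mul_cardG (E0 <*> F) Y; rewrite /= GY card_off_line_joing oY oZ.
  rewrite -cent_joinEr //= => e; apply/eqP/eqP.
  by rewrite -(eqn_pmul2r p_gt0) -e -expnD -expnSr; apply/eqP; congr (p ^ _)%N; lia.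
by rewrite /= cent_joing3.
Qed.

(** X contains both E0 and F, which do not commute. Centralizing E0 and then F each
    cuts the order of X by p, and E0 F recovers X from the rest. *)
Lemma counted_restrict n X : counted n.+1 Q X -> F \subset X ->
  counted n [group of 'C_M(F)] [group of X :&: 'C_M(F)] /\
  E0 <*> F <*> (X :&: 'C_M(F)) = X.
Proof.
move=> gX sFX; have /and5P[sZX sXQ eX dX /andP[/eqP oX OX]] := gX.
have sE0X := counted_E0 gX; have sXP := subset_trans sXQ sQP.
have ncX : ~~ (X \subset 'C(E0)).
  by apply: contra off_line_ncent; apply: subset_trans.
have c1 : (#|X| = p * #|X :&: M|)%N.
  rewrite setIA (setIidPl sXQ); apply: card_cent_rank2 => //.
  by apply: subset_trans commE0Q; apply: commgS.
have c2 : (#|X :&: M| = p * #|X :&: M :&: 'C(F)|)%N.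
  apply: (@card_cent_rank2 F [group of X :&: M]) => //.
  - by apply: subset_trans sXP; apply: subsetIl.
  - by apply: subset_trans dX; apply: commgSS => //; apply: subsetIl.
  apply: contra off_line_ncent => cXF; rewrite centsC (subset_trans _ cXF) //.
  by rewrite subsetI sE0X sE0M.
have oY : #|X :&: 'C_M(F)| = (p ^ n.*2.+1)%N.
  apply/eqP; rewrite setIA -(eqn_pmul2l p_gt0) -c2 -(eqn_pmul2l p_gt0) -c1 oX.
  by rewrite -!expnS.
have sZC : Z \subset 'C_M(F).
  by rewrite subsetI sZM centsC (centZ (subset_trans sFQ sQP)).
have eXY : E0 <*> F <*> (X :&: 'C_M(F)) = X.
  have sY : X :&: 'C_M(F) \subset 'C_M(F) := subsetIr _ _.
  have cYG : X :&: 'C_M(F) \subset 'C(E0 <*> F).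
    rewrite centY subsetI (subset_trans sY) /=; last first.
      by apply: subset_trans (subsetIl _ _) _; apply: subsetIr.
    by apply: subset_trans sY _; apply: subsetIr.
  have GY : (E0 <*> F) :&: (X :&: 'C_M(F)) = Z.
    apply/eqP; rewrite eqEsubset; apply/andP; split.
      apply: subset_trans (setIS _ sY) _; by rewrite off_line_joing_cent.
    by rewrite subsetI (subset_trans sZF (joing_subr _ _)) subsetI sZX sZC.
  have := mul_cardG (E0 <*> F) [group of X :&: 'C_M(F)].
  rewrite /= GY card_off_line_joing oY oZ -cent_joinEr //= => e.
  apply/eqP; rewrite eqEcard; apply/andP; split.
    by rewrite !join_subG sE0X sFX subsetIl.
  rewrite -(leq_pmul2r p_gt0) -e oX -expnD -expnSr leq_exp2l //; lia.
split=> //; apply/and5P; split.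
- by rewrite subsetI sZX.
- exact: subsetIr.
- by apply: dvdn_trans (exponentS _) eX; apply: subsetIl.
- by apply: subset_trans dX; apply: dergS; apply: subsetIl.
by rewrite /= oY eqxx -cent_joing3 eXY.
Qed.

(** The maps Y |-> E0 F Y and X |-> C_X(E0 F) are inverse bijections. *)
Lemma card_counted_off_line n : #|[set Y | counted n [group of 'C_M(F)] Y]| =
  #|[set X | counted n.+1 Q X && (F \subset X)]|.
Proof.
pose f Y := [group of E0 <*> F <*> Y].
pose g X := [group of X :&: 'C_M(F)].
have oG m H X : counted m H X -> #|X| = (p ^ m.*2.+1)%N.
  by case/and5P=> _ _ _ _ /andP[/eqP].
have fP Y : counted n [group of 'C_M(F)] Y -> counted n.+1 Q (f Y) && (F \subset f Y).
  move=> gY; rewrite (counted_extend gY) /=.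
  by rewrite (subset_trans (joing_subr E0 _)) // joing_subl.
have fK Y : counted n [group of 'C_M(F)] Y -> g (f Y) = Y.
  move=> gY; have /andP[gfY sFY] := fP _ gY.
  have [ggY _] := counted_restrict gfY sFY.
  apply/esym/val_inj/eqP; rewrite eqEcard (oG _ _ _ gY) (oG _ _ _ ggY) leqnn andbT.
  by rewrite subsetI joing_subr; case/and5P: gY.
have gK X : counted n.+1 Q X -> F \subset X -> f (g X) = X.
  by move=> gX sFX; apply/val_inj; case: (counted_restrict gX sFX).
have gP X : counted n.+1 Q X && (F \subset X) -> counted n [group of 'C_M(F)] (g X).
  by case/andP=> gX sFX; exact: (counted_restrict gX sFX).1.
move: f g (counted n [group of 'C_M(F)]) (counted n.+1 Q) => f g a b in fP fK gK gP *.
apply/eqP; rewrite eqn_leq; apply/andP; split.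
  rewrite -(card_in_imset (f := f) (D := mem [set Y | a Y])).
    by apply/subset_leq_card/subsetP=> _ /imsetP[Y gY ->]; rewrite !inE in gY *; apply: fP.
  by move=> Y Y'; rewrite !inE => gY gY' e; rewrite -(fK _ gY) -(fK _ gY') e.
rewrite -(card_in_imset (f := g) (D := mem [set X | b X && (F \subset X)])).
  by apply/subset_leq_card/subsetP=> _ /imsetP[X gX ->]; rewrite !inE in gX *; apply: gP.
move=> X X'; rewrite !inE => /andP[gX sX] /andP[gX' sX'] e.
by rewrite -(gK _ gX sX) -(gK _ gX' sX') e.
Qed.

Lemma off_line_mul : F * M = Q.
Proof.
apply/eqP; rewrite eqEcard mul_subG ?sMQ //= cardQM.
by rewrite -(leq_pmul2r p_gt0) -[X in _ <= _ * X]oZ -FM -mul_cardG oF mulnAC expnS expn1.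
Qed.

(** F M = Q, so the modular law gives G = F (G :&: M); if G :&: M were Z, then G
    would be F. *)
Lemma off_line_proper G : F \proper G -> G \subset Q -> Z \proper G :&: M.
Proof.
move=> /properP[sFG [x Gx nFx]] sGQ.
rewrite properEneq subsetI sZM (subset_trans sZF sFG) !andbT.
apply: contraNneq nFx => e.
have : F * (M :&: G) = F * M :&: G := group_modl M sFG.
by rewrite setIC -e mulGSid // off_line_mul (setIidPr sGQ) => ->.
Qed.
End OneF.

(** An element x of X outside M lies in exactly one such F, namely <x> Z, and each F
    has p^2 - p elements outside M, those outside Z. There are
    p^(2n+3) - p^(2n+2) elements in X outside M. *)
Lemma card_off_line_in n X : counted n.+1 Q X ->
  #|[set F : {group gT} | off_line F && (F \subset X)]| = (p ^ n.*2.+1)%N.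
Proof.
move=> gX; have /and5P[sZX sXQ /exponentP eX dX /andP[/eqP oX OX]] := gX.
have sE0X := counted_E0 gX; have sXP := subset_trans sXQ sQP.
have ncX : ~~ (X \subset 'C(E0)).
  apply/negP=> cXE0; have : E0 \subset Z.
    by rewrite -(counted_center sQP gX) subsetI sE0X centsC.
  by move/subset_leq_card; rewrite oE0 leqNgt card_rank2_Z.
have c1 : (#|X| = p * #|X :&: M|)%N.
  rewrite setIA (setIidPl sXQ); apply: card_cent_rank2 => //.
  by apply: subset_trans commE0Q; apply: commgS.
have oXM : #|X :&: M| = (p ^ n.+1.*2)%N.
  by apply/eqP; rewrite -(eqn_pmul2l p_gt0) -c1 oX -expnS.
have cXM : #|X :\: M| = (p ^ n.*2.+1 * (p ^ 2 - p))%N.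
  by rewrite cardsD oX oXM mulnBr -expnD -expnSr doubleS addn2.
set N := #|_|; apply/eqP; rewrite -(eqn_pmul2r (_ : 0 < p ^ 2 - p)%N); last first.
  by rewrite subn_gt0 -{1}(expn1 p) ltn_exp2l.
rewrite -cXM.
have -> : (N * (p ^ 2 - p) = \sum_(F in [set F : {group gT} | off_line F && (F \subset X)])
    \sum_(x in X :\: M) (x \in F))%N.
  rewrite -sum_nat_const; apply: eq_bigr => F; rewrite inE => /andP[hF sFX].
  have /and5P[_ _ sZF /eqP oF /eqP FM] := hF.
  have eFZ : F :\: Z = (X :\: M) :&: F.
    by rewrite -FM setDIr setDv set0U setIC setIDA (setIidPl sFX).
  transitivity #|F :\: Z|; first by rewrite cardsD (setIidPr sZF) oF oZ.
  rewrite eFZ -sum1_card big_mkcond [RHS]big_mkcond; apply: eq_bigr => x _.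
  by rewrite in_setI; case: (x \in X :\: M); case: (x \in F).
rewrite exchange_big -sum1_card; apply/eqP/eq_bigr => x /setDP[Xx nMx].
pose F0 := [group of <[x]> <*> Z].
have nZx : x \notin Z by apply: contra nMx; apply/subsetP/sZM.
have [abF0 oF0] := rank2_of_elt (subsetP sXP _ Xx) (eX _ Xx) nZx.
have sF0X : F0 \subset X by rewrite join_subG cycle_subG Xx.
have F0x : x \in F0 by rewrite mem_gen // inE cycle_id.
have hF0 : off_line F0.
  rewrite /off_line abF0 joing_subr oF0 eqxx (subset_trans sF0X) //=.
  rewrite eq_sym eqEproper subsetI joing_subr sZM /=; apply/negP=> pr.
  case/negP: nMx; have e := @eq_rank2 [group of F0 :&: M] F0 oF0 pr (subsetIl _ _).
  by move: F0x; rewrite -e => /setIP[].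
rewrite (bigD1 F0) /= ?inE ?hF0 ?sF0X //= F0x big1 // => F /andP[].
rewrite inE => /andP[hF _] nF; case Fx: (x \in F) => //; case/eqP: nF.
have /and5P[_ _ sZF /eqP oF _] := hF.
apply/val_inj; rewrite /= (@rank2_gen F x) // inE nZx Fx //.
Qed.

(** Both sides count the pairs of F and X with F inside X. *)
Lemma sum_card_counted n :
  (\sum_(F : {group gT} | off_line F) #|[set Y | counted n [group of 'C_M(F)] Y]| =
   #|[set X | counted n.+1 Q X]| * p ^ n.*2.+1)%N.
Proof.
transitivity (\sum_(F : {group gT} | off_line F) \sum_(X | counted n.+1 Q X) (F \subset X))%N.
  apply: eq_bigr => F hF; rewrite (card_counted_off_line hF) -sum1dep_card.
  rewrite big_mkcond [RHS]big_mkcond; apply: eq_bigr => X _.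
  by case: (counted n.+1 Q X); case: (F \subset X).
rewrite exchange_big /= -sum1dep_card big_distrl /=; apply: eq_bigr => X gX.
rewrite mul1n -(card_off_line_in gX) -sum1dep_card.
rewrite big_mkcond [RHS]big_mkcond; apply: eq_bigr => F _.
by case: (off_line F); case: (F \subset X).
Qed.
End Step.
End PrimeCentral.

(** * Posets of elementary abelian subgroups *)

Lemma sqrnS n : (n.+1 ^ 2 = n.*2.+1 + n ^ 2)%N.
Proof. by rewrite -!mulnn; lia. Qed.

Section Posets.
Import GroupScope.
Variables (gT : finGroupType) (p : nat) (P : {group gT}).
Local Notation T := (abelem_ge2 p P).
Implicit Types (s : pred {group gT}) (h : {group gT} -> {group gT}) (E F : T)
  (G H : {group gT}) (n : nat) (I : finType).

Definition elem G := (G \in 'E_p(P)) && (p ^ 2 <= #|G|)%N.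

Lemma elemI G : G \subset P -> p.-abelem G -> (p ^ 2 <= #|G|)%N -> elem G.
Proof. by move=> sGP abG geG; apply/andP; split=> //; apply/pElemP. Qed.

Lemma val_sub E : val E \subset P.
Proof. by case/andP: (valP E) => /pElemP[]. Qed.

Lemma val_abelem E : p.-abelem (val E).
Proof. by case/andP: (valP E) => /pElemP[]. Qed.

Lemma val_card E : (p ^ 2 <= #|val E|)%N.
Proof. by case/andP: (valP E). Qed.

Definition members s : pred T := fun E => s (val E).
(** The default value E keeps this total; it is used only where h E is in the poset. *)
Definition lift_op h E : T := insubd E (h (val E)).

Lemma val_lift_op h E : elem (h (val E)) -> val (lift_op h E) = h (val E).
Proof. by move=> hE; rewrite val_insubd (hE : _ && _). Qed.

Lemma leT E F : (E <= F)%O = (val E \subset val F). Proof. by []. Qed.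

Lemma ltT E F : (E < F)%O = (val E \proper val F).
Proof.
rewrite Order.POrderTheory.lt_neqAle leT properEneq; congr (~~ _ && _).
Qed.

Section Op.
Variables (s s' : pred {group gT}) (h : {group gT} -> {group gT}).
Hypothesis ss : forall E, s' (val E) -> s (val E).
Hypothesis hs : forall E, s (val E) -> elem (h (val E)) && s' (h (val E)).
Hypothesis hm : forall G H, G \subset H -> h G \subset h H.
Hypothesis hid : forall E, s' (val E) -> h (val E) = val E.
Hypothesis hc : (forall G, h G \subset G) \/ (forall G, G \subset h G).

Let r := lift_op h.
Let val_r E : s (val E) -> val (r E) = h (val E).
Proof. by move=> /hs /andP[hE _]; apply: val_lift_op. Qed.

Let r1 E : members s' E -> members s E. Proof. exact: ss. Qed.
Let r2 E : members s E -> members s' (r E).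
Proof. by move=> sE; rewrite /members val_r //; case/andP: (hs sE). Qed.
Let r3 E F : members s E -> members s F -> (E <= F -> r E <= r F)%O.
Proof. by move=> sE sF; rewrite !leT !val_r //; apply: hm. Qed.
Let r4 E : members s' E -> r E = E.
Proof. by move=> sE; apply: val_inj; rewrite val_r ?hid //; apply: ss. Qed.
Let r5 : (forall E, members s E -> r E <= E)%O \/ (forall E, members s E -> E <= r E)%O.
Proof.
by case: hc => le; [left | right] => E sE; rewrite leT val_r //; apply: le.
Qed.

Lemma free_homology_op n I : free_homology (members s) n I <-> free_homology (members s') n I.
Proof. exact: free_homology_retract r1 r2 r3 r4 r5 n I. Qed.

Lemma acyclic_op n : acyclic_on (members s') n -> acyclic_on (members s) n.
Proof. exact: acyclic_retract r1 r2 r3 r5 n. Qed.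
End Op.

Lemma eq_free_homology (S S' : pred T) n I : S =1 S' -> free_homology S n I -> free_homology S' n I.
Proof. by move=> /funext ->. Qed.

Lemma eq_acyclic (S S' : pred T) n : S =1 S' -> acyclic_on S n -> acyclic_on S' n.
Proof. by move=> /funext ->. Qed.

Variable Z : {group gT}.
Hypotheses (p_pr : prime p) (p_odd : odd p) (pP : p.-group P).
Hypotheses (oZ : #|Z| = p) (sZ : Z \subset 'Z(P)).
Local Notation counted := (counted p Z).

Definition above_in (Q G : {group gT}) := (Z \proper G) && (G \subset Q).

Lemma elem_proper G : G \subset P -> p.-abelem G -> Z \proper G -> elem G.
Proof.
move=> sGP abG prG; apply: elemI => //.
by apply: (proper_card_ge p_pr oZ _ prG); apply: pgroupS pP.
Qed.

(** E <= E A >= A: the poset retracts onto the subgroups over A, of which A is the least. *)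
Lemma acyclic_central (Q A : {group gT}) : Q \subset P -> A \subset 'Z(Q) ->
    p.-abelem A -> Z \proper A ->
  forall n, acyclic_on (members (above_in Q)) n.
Proof.
move=> sQP sAZ abA prA n; have sAQ := subset_trans sAZ (center_sub Q).
have eA : elem A by apply: elem_proper => //; apply: subset_trans sQP.
apply: (@acyclic_op _ (fun G => above_in Q G && (A \subset G)) (fun G => (G <*> A)%G)).
- by move=> E /andP[].
- move=> E /andP[prE sEQ].
  have prEA : Z \proper (val E <*> A)%G by apply: proper_sub_trans prE (joing_subl _ _).
  have sEAQ : (val E <*> A)%G \subset Q by rewrite join_subG sEQ.
  rewrite /above_in prEA sEAQ joing_subr !andbT; apply: elem_proper => //.
    exact: subset_trans sQP.
  apply: abelemY (val_abelem E) abA _; apply: subset_trans sAZ _.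
  by apply: subset_trans (subsetIr _ _) _; rewrite centS.
- by move=> G H sGH; apply: genS; apply: setSU.
- by apply: or_intror => G; apply: (joing_subl G A).
pose m : T := exist _ A eA.
apply: (@acyclic_min _ _ _ m); first by rewrite /members /above_in /= prA sAQ subxx.
by move=> E /andP[_ sAE].
Qed.

Lemma card_counted_central (Q A : {group gT}) n : Q \subset P -> A \subset 'Z(Q) ->
    p.-abelem A -> Z \proper A -> #|[set X | counted n Q X]| = 0%N.
Proof.
move=> sQP sAZ; rewrite abelemE // => /andP[_ /exponentP eA] /properP[_ [x Ax nZx]].
apply: eq_card0 => X; rewrite !inE; apply/negP=> gX; case/negP: nZx.
have /setIP[Qx Cx] := subsetP sAZ _ Ax.
apply: (counted_cent pP sQP gX) => //; last exact: eA.
by apply: (subsetP _ _ Cx); apply: centS; case/and5P: gX.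
Qed.

Lemma elem_in (Q : {group gT}) x : Q \subset P -> Z \subset Q ->
    x \in Q -> x ^+ p = 1 -> x \notin Z ->
  exists E : T, members (above_in Q) E.
Proof.
move=> sQP sZQ Qx xp nZx.
have [abF oF] := rank2_of_elt p_pr oZ sZ (subsetP sQP _ Qx) xp nZx.
have sFQ : <[x]> <*> Z \subset Q by rewrite join_subG cycle_subG Qx.
have eF : elem (<[x]> <*> Z)%G by apply: elemI; rewrite ?oF // (subset_trans sFQ).
pose E : T := exist _ (<[x]> <*> Z)%G eF.
exists E; rewrite /members /above_in /= sFQ andbT properE joing_subr.
by apply: contra nZx; rewrite join_subG cycle_subG => /andP[].
Qed.

Lemma counted0P (Q X : {group gT}) : Q \subset P -> Z \subset Q ->
  counted 0 Q X = (X == Z) && ('Ohm_1(Q) \subset Z).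
Proof.
move=> sQP sZQ; have cZQ := centZ sZ sQP.
have CQZ : 'C_Q(Z) = Q by apply/setIidPl.
have abZ := abelemZ p_pr oZ.
have pQ : p.-group Q := pgroupS sQP pP.
have eZ : exponent Z %| p by move: abZ; rewrite abelemE // => /andP[].
have sZO : Z \subset 'Ohm_1(Q) by apply: (exponent_sub_Ohm1 pQ).
apply/idP/andP => [/and5P[sZX _ _ _ /andP[/eqP oX OX]] | [/eqP -> sOZ]].
  have eXZ : X = Z by apply/esym/val_inj/eqP; rewrite eqEcard sZX oX oZ expn1 leqnn.
  by rewrite eXZ CQZ in OX *; rewrite (eqP OX) eqxx subxx.
apply/and5P; split=> //; first by rewrite (derG1P (abelem_abelian abZ)) sub1G.
by rewrite oZ expn1 eqxx CQZ eqEsubset sOZ sZO.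
Qed.

(** The subgroups strictly over F = [val b] and those over Z in C_M(F) are retracts of
    their union U, under E |-> F E and E |-> E :&: M respectively. *)
Lemma free_homology_link (Q E0 : {group gT}) (b : T) n I :
    Q \subset P -> Z \subset Q -> 'Ohm_1('Z(Q)) = Z -> E0 <| Q -> p.-abelem E0 ->
    #|E0| = (p ^ 2)%N -> Z \subset E0 -> off_line p Z Q E0 (val b) ->
  free_homology (members (above_in [group of 'C_('C_Q(E0))(val b)])) n I ->
  free_homology [pred x | members (above_in Q) x & (b < x)%O] n I.
Proof.
move=> sQP sZQ OZ nE0 abE0 oE0 sZE0 hb; set F := val b in hb *.
set M := 'C_Q(E0); set CM := [group of 'C_M(F)] => hCM.
have /and5P[sFQ abF sZF /eqP oF /eqP FM] := hb.
have sCQ : CM \subset Q by apply: subset_trans (subsetIl _ _) (subsetIl _ _).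
have sMQ : M \subset Q by apply: subsetIl.
have prF : Z \proper F.
  by rewrite properEcard sZF oZ oF -{1}(expn1 p) ltn_exp2l ?prime_gt1.
pose link G := above_in Q G && (F \proper G).
pose U G := link G || above_in CM G.
apply: (@eq_free_homology (members link)) => [x|].
  by rewrite /members /link /= ltT.
have eU G : G \subset P -> p.-abelem G -> U G -> [/\ F \subset 'C(G), G \subset Q & Z \proper G].
  move=> sGP abG /orP[/andP[/andP[prG sGQ] prFG] | /andP[prG sGC]]; split=> //.
  - by rewrite (subset_trans (proper_sub prFG)) //; apply: abelem_abelian abG.
  - by rewrite centsC (subset_trans sGC) // subsetIr.
  exact: subset_trans sCQ.
have UF : free_homology (members U) n I <-> free_homology (members link) n I.
  apply: (@free_homology_op U link (fun G => (F <*> G)%G)).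
  - by move=> E linkE; rewrite /U linkE.
  - move=> E UE; have [cFE sEQ prE] := eU _ (val_sub E) (val_abelem E) UE.
    have sFEQ : F <*> val E \subset Q by rewrite join_subG sFQ.
    have prFE : Z \proper F <*> val E by apply: proper_sub_trans prE (joing_subr _ _).
    have pr : F \proper F <*> val E.
      rewrite properE joing_subl /=; apply/negP; rewrite join_subG subxx /= => sEF.
      case/orP: UE => [/andP[_ prFE']|/andP[_ sEC]].
        by have := proper_sub_trans prFE' sEF; rewrite properxx.
      have sEZ : val E \subset Z by rewrite -FM subsetI sEF (subset_trans sEC) // subsetIl.
      by have := proper_sub_trans prE sEZ; rewrite properxx.
    rewrite /link /above_in sFEQ pr prFE !andbT; apply: elem_proper => //.
      exact: subset_trans sQP.
    by apply: abelemY; rewrite ?val_abelem // centsC.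
  - by move=> G H sGH; apply: genS; apply: setUS.
  - by move=> E /andP[_ prFE]; apply/val_inj/joing_idPr/proper_sub.
  by apply: or_intror => G; apply: (joing_subr F G).
have UC : free_homology (members U) n I <-> free_homology (members (above_in CM)) n I.
  apply: (@free_homology_op U (above_in CM) (fun G => (G :&: M)%G)).
  - by move=> E sE; rewrite /U sE orbT.
  - move=> E UE; have [cFE sEQ prE] := eU _ (val_sub E) (val_abelem E) UE.
    have sEC : val E :&: M \subset CM.
      by rewrite subsetI subsetIr (subset_trans (subsetIl _ _)) // centsC.
    have prEM : Z \proper val E :&: M.
      case/orP: UE => [/andP[_ prFE]|/andP[_ sECM]].
        exact: (off_line_proper p_pr pP oZ sZ sQP OZ nE0 abE0 oE0 sZE0 hb).
      by rewrite (setIidPl _) // (subset_trans sECM) // subsetIl.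
    rewrite /above_in sEC prEM !andbT; apply: elem_proper => //.
      by rewrite (subset_trans sEC) // (subset_trans sCQ).
    exact: abelemS (subsetIl _ _) (val_abelem E).
  - by move=> G H sGH; apply: setSI.
  - move=> E /andP[_ sEC]; apply/val_inj/setIidPl.
    by apply: subset_trans sEC _; apply: subsetIl.
  by apply: or_introl => G; apply: subsetIl.
exact/UF/UC.
Qed.

(** Induction on n. The rank of the homology and the number of counted subgroups
    satisfy the same recursion over the subgroups F, by [free_homology_minimal_card]
    and [sum_card_counted]; the powers of p agree because (n+1)^2 = (2n+1) + n^2. *)
Lemma free_homology_above n (Q : {group gT}) : Q \subset P -> Z \subset Q ->
  free_homology (members (above_in Q)) n 'I_(#|[set X | counted n Q X]| * p ^ (n ^ 2))%N.
Proof.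
elim: n Q => [|n IH] Q sQP sZQ; have pQ : p.-group Q := pgroupS sQP pP;
  case: (pselect (exists E : T, members (above_in Q) E)) => [[E sE] | noE].
(* Not empty, n = 0: Z is not Ohm_1(Q), so that nothing is counted. *)
- apply: acyclic_free_homology; last exact: acyclic0 sE.
  rewrite card_ord (_ : #|_| = 0%N) //; apply: eq_card0 => X.
  rewrite !inE counted0P //; apply/negP=> /andP[_ sOZ]; have /andP[prE sEQ] := sE.
  case/proper_subn/negP: prE; apply: subset_trans sOZ.
  apply: (exponent_sub_Ohm1 pQ) => //.
  by have := val_abelem E; rewrite abelemE // => /andP[].
(* Empty, n = 0: all elements of order p of Q are in Z. *)
- apply: free_homology_empty0 => [x|]; first by apply/negP=> sx; apply: noE; exists x.
  rewrite card_ord muln1 (_ : [set X | _] = [set Z]) ?cards1 //.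
  apply/setP=> X; rewrite !inE counted0P //.
  suff -> : 'Ohm_1(Q) \subset Z by rewrite andbT.
  rewrite (OhmE 1 pQ) gen_subG; apply/subsetP=> x /LdivP[Qx xp].
  by apply: contrapT => /negP nZx; apply/noE/(elem_in sQP sZQ Qx).
- have sOQ : 'Ohm_1('Z(Q)) \subset 'Z(Q) := Ohm_sub _ _.
  have pZQ : p.-group 'Z(Q) by apply: pgroupS pQ; apply: center_sub.
  have abO : p.-abelem 'Ohm_1('Z(Q)) by apply: Ohm1_abelem; rewrite ?center_abelian.
  have sZZ : Z \subset 'Z(Q).
    by rewrite subsetI sZQ centsC (centZ sZ).
  have sZO : Z \subset 'Ohm_1('Z(Q)).
    apply: (exponent_sub_Ohm1 pZQ) => //.
    by have := abelemZ p_pr oZ; rewrite abelemE // => /andP[].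
  have [OZ|nOZ] := eqVneq 'Ohm_1('Z(Q)) Z; last first.
    have pr : Z \proper 'Ohm_1('Z(Q)) by rewrite properEneq eq_sym nOZ.
    apply: acyclic_free_homology; last exact: acyclic_central sQP sOQ abO pr _.
    by rewrite card_ord (card_counted_central n.+1 sQP sOQ abO pr).
  have /andP[prE sEQ] := sE.
  have [E0 [nE0 abE0 oE0 sZE0]] :=
    exists_normal_rank2 p_pr p_odd pP oZ sZ sQP sZQ OZ sEQ (val_abelem E) prE.
  pose M := [group of 'C_Q(E0)].
  pose off := off_line p Z Q E0.
  pose B := [set F : T | off (val F)].
  have sMQ : M \subset Q := subsetIl _ _.
  have sMP := subset_trans sMQ sQP.
  have sZM : Z \subset M by apply: subset_trans sZE0 (sE0M nE0 abE0).
  have propZ (G : {group gT}) : Z \subset G -> (p ^ 2 <= #|G|)%N -> Z \proper G.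
    move=> sZG geG; rewrite properEcard sZG oZ (leq_trans _ geG) //.
    by rewrite -{1}(expn1 p) ltn_exp2l ?prime_gt1.
  have sB : {subset B <= members (above_in Q)}.
    move=> F; rewrite inE => /and5P[sFQ _ sZF /eqP oF _].
    by apply/andP; split=> //; apply: propZ; rewrite ?oF.
  have minB b x : b \in B -> members (above_in Q) x -> ~~ (x < b)%O.
    rewrite inE => /and5P[_ _ _ /eqP ob _] _; apply/negP; rewrite ltT => /proper_card.
    by rewrite ob ltnNge val_card.
  (* The elements that meet M outside Z retract onto those inside M, and E0 is *)
  (* central in M. *)
  have acS0 m : acyclic_on [pred x | members (above_in Q) x & x \notin B] m.
    apply: (@eq_acyclic (members (fun G => above_in Q G && ~~ off G))).
      by move=> x; rewrite /= inE.
    apply: (@acyclic_op _ (above_in M) (fun G => (G :&: M)%G)).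
    + move=> F /andP[prF sFM]; rewrite /above_in prF (subset_trans sFM) //=.
      apply/negP=> /and5P[_ _ _ _ /eqP FM].
      by move: prF; rewrite -FM (setIidPl sFM) properxx.
    + move=> F /andP[/andP[prF sFQ] noff].
      have prFM : Z \proper (val F :&: M)%G.
        rewrite properEneq subsetI (proper_sub prF) sZM !andbT.
        apply: contraNneq noff => e.
        by apply: (off_line_of_meet p_pr pP oZ sZ sQP OZ nE0 abE0 oE0 sZE0 sFQ
          (val_abelem F) (val_card F) (esym e)).
      rewrite /above_in prFM subsetIr !andbT; apply: elem_proper => //.
        by rewrite (subset_trans (subsetIr _ _)).
      exact: abelemS (subsetIl _ _) (val_abelem F).
    + by move=> G H sGH; apply: setSI.
    + by apply: or_introl => G; apply: subsetIl.
    apply: (@acyclic_central M E0) => //; last by apply: propZ; rewrite ?oE0.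
    by rewrite subsetI (sE0M nE0 abE0) centsC subsetIr.
  pose cnt (F : {group gT}) := (#|[set Y | counted n [group of 'C_M(F)] Y]|)%N.
  pose r (F : T) := (cnt (val F) * p ^ (n ^ 2))%N.
  apply: (free_homology_minimal_card sB minB acS0 (r := r)); last first.
    rewrite card_ord -big_distrl /=.
    have -> : (\sum_(b in B) cnt (val b) = \sum_(F : {group gT} | off F) cnt F)%N.
      rewrite (reindex_omap val (insub : _ -> option T)) /=; last first.
        move=> F hF; rewrite insubT //; have /and5P[sFQ abF _ /eqP oF _] := hF.
        by apply: elemI; rewrite ?oF // (subset_trans sFQ).
      by apply: eq_bigl => F; rewrite inE valK eqxx andbT.
    rewrite /off /cnt (sum_card_counted p_pr p_odd pP oZ sZ sQP nE0 abE0 oE0 sZE0) -mulnA -expnD.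
    by rewrite -sqrnS.
  move=> F; rewrite inE => oF.
  apply: (free_homology_link (E0 := E0)) => //; apply: IH.
    by apply: subset_trans sMP; apply: subsetIl.
  by rewrite subsetI sZM centsC (centZ sZ) // (subset_trans _ sQP) //; case/and5P: oF.
(* Empty, n > 0: an element x outside Z of a counted X would give <x> Z. *)
apply: acyclic_free_homology; last first.
  by apply: acyclic_empty => x; apply/negP=> sx; apply: noE; exists x.
rewrite card_ord (_ : #|_| = 0%N) //; apply: eq_card0 => X.
rewrite !inE; apply/negP=> gX.
have /and5P[sZX sXQ /exponentP eX _ /andP[/eqP oX _]] := gX.
have : ~~ (X \subset Z).
  by apply/negP=> /subset_leq_card; rewrite oX oZ -{2}(expn1 p) leq_exp2l ?prime_gt1.
case/subsetPn=> x Xx nZx; apply: noE.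
by apply: (elem_in sQP sZQ) nZx; [apply: (subsetP sXQ) | apply: eX].
Qed.

(** E <= E Z, and E Z is strictly larger than Z as E has order at least p^2. *)
Lemma free_homology_all n I :
  free_homology (members (above_in P)) n I -> free_homology (xpredT : pred T) n I.
Proof.
move=> hP; apply: (@eq_free_homology (members xpredT)) => //.
apply/(@free_homology_op xpredT (above_in P) (fun G => (G <*> Z)%G)) => //.
- move=> E _; have sEZP : val E <*> Z \subset P.
    by rewrite join_subG val_sub (subset_trans sZ) // center_sub.
  have prE : Z \proper val E <*> Z.
    rewrite properEcard joing_subr oZ.
    have /leq_trans := val_card E; move=> /(_ _ (subset_leq_card (joing_subl _ Z))).
    by apply: leq_trans; rewrite -{1}(expn1 p) ltn_exp2l ?prime_gt1.
  rewrite /above_in prE sEZP !andbT; apply: elem_proper => //.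
  apply: abelemY (val_abelem E) (abelemZ p_pr oZ) _.
  by rewrite centsC (centZ sZ) // val_sub.
- by move=> G H sGH; apply: genS; apply: setSU.
- by move=> E /andP[prE _]; apply/val_inj/joing_idPl/proper_sub.
by apply: or_intror => G; apply: (joing_subl G Z).
Qed.

(** Z is contained in Ohm_1(C_P(X)), which for an extraspecial X as in the theorem is
    Z(X), of order p; hence Z(X) = Z. *)
Lemma card_extraspecial n :
  extraspecial_count p P n.+1 = #|[set X | counted n.+1 P X]|.
Proof.
apply: eq_card => X; rewrite !inE; apply/idP/idP => [/and3P[sXP] | gX].
  case/and3P=> /and3P[/eqP oZX abXZ _] eX oX OX.
  have pX := pgroupS sXP pP.
  have sZO : Z \subset 'Ohm_1('C_P(X)).
    have pC : p.-group 'C_P(X) by apply: pgroupS pP; apply: subsetIl.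
    apply: (exponent_sub_Ohm1 pC); last first.
      by have := abelemZ p_pr oZ; rewrite abelemE // => /andP[].
    by rewrite subsetI (subset_trans sZ (center_sub P)) centsC (centZ sZ).
  have eZ : Z = 'Z(X) :> {set gT}.
    by apply/eqP; rewrite eqEcard -{1}(eqP OX) sZO oZ oZX leqnn.
  apply/and5P; split=> //; rewrite ?eX ?eZ ?center_sub ?oX ?OX //.
  apply: der1_min; first exact: normal_norm (center_normal X).
  exact: abelem_abelian abXZ.
have /and5P[sZX sXP eX _ /andP[oX OX]] := gX.
rewrite sXP (counted_pextraspecial p_pr pP oZ sZ (subxx P) gX) eX oX.
by rewrite (counted_center pP sZ (subxx P) gX) OX.
Qed.
End Posets.

Theorem corollary1p6 (gT : finGroupType) (p : nat) (P : {group gT})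
    (p_prime : prime p) (p_odd : odd p) (pP : (p.-group P)%g) (l : nat) :
  zmod_isog (reduced_homology (abelem_ge2 p P) l)
            'rV[int]_(extraspecial_count p P l.+1 * p ^ (l.+1 ^ 2)).
Proof.
apply: (@free_homology_isog _ _ l _ _ (card_ord _)).
have [P1|ntP] := eqVneq (P : {set gT}) 1%g.
  have oP : #|P| = 1 by rewrite P1 cards1.
  have noT (E : abelem_ge2 p P) : False.
    have := leq_trans (val_card E) (subset_leq_card (val_sub E)).
    by rewrite oP leqNgt -{1}(expn0 p) ltn_exp2l ?prime_gt1.
  apply: acyclic_free_homology; last by apply: acyclic_empty => E; case: (noT E).
  rewrite card_ord (_ : extraspecial_count p P l.+1 = 0) //; apply: eq_card0 => X.
  rewrite !inE; apply/negP=> /and3P[sXP /and3P[_ _ /eqP oX] _].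
  have := subset_leq_card sXP.
  by rewrite oX oP leqNgt -{1}(expn0 p) ltn_exp2l ?prime_gt1.
have ntZ : 'Z(P)%g != 1%g.
  by apply: contraNneq ntP => /(trivg_center_pgroup pP) ->.
have [_ pZ _] := pgroup_pdiv (pgroupS (center_sub P) pP) ntZ.
have [x Zx ox] := Cauchy p_prime pZ.
have sZ : (<[x]> \subset 'Z(P))%g by rewrite cycle_subG.
have oZ : #|<[x]>%G| = p by rewrite /= -orderE.
apply: (free_homology_all p_prime pP oZ sZ).
rewrite (card_extraspecial p_prime pP oZ sZ).
apply: (free_homology_above p_prime p_odd pP oZ sZ) => //.
by rewrite (subset_trans sZ) // center_sub.
Qed.
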